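(* Let $V$ be a finite-dimensional vector space over $k$ with a braiding $R:V\otimes V\to V\otimes V$. Then $$P_R(V)^{op} = A(R)^\circ ,$$ where $P_R(V)^{op}$ is the $R$-transformation algebra of $V$ with the order of multiplication reversed and $A(R)^\circ$ is the finite dual of the FRT (Faddeev-Reshetikhin-Takhtajan) bialgebra $A(R)$.
   Context: $k$ is $\mathbb{R}$ or $\mathbb{C}$. A linear map $\sigma:C\to \mathrm{Hom}_k(A,B)$ from a coalgebra $C$, with $A,B$ algebras, is a measuring map if $\sigma(c)(aa')=\sum_{(c)}\sigma(c_{(1)})(a)\,\sigma(c_{(2)})(a')$ and $\sigma(c)(1_A)=\epsilon(c)1_B$. The universal measuring coalgebra $\pi:P(A,B)\to \mathrm{Hom}(A,B)$ is the measuring coalgebra such that for every measuring map $\sigma:C\to\mathrm{Hom}(A,B)$ there is a unique coalgebra map $\rho:C\to P(A,B)$ with $\pi\circ\rho=\sigma$. $P(A,A)$ is a bialgebra with multiplication induced by composition in $\mathrm{End}(A)$, and $\pi$ is then an algebra homomorphism. For an algebra $A$, $A^\circ=P(A,k)\subset\mathrm{Hom}(A,k)$ is the finite dual (dual coalgebra) of $A$; when $A$ is a bialgebra, $A^\circ$ is a bialgebra with the convolution product. A braiding on $V$ is an invertible linear map $R:V\otimes V\to V\otimes V$ satisfying $(\mathrm{id}\otimes R)(R\otimes\mathrm{id})(\mathrm{id}\otimes R)=(R\otimes\mathrm{id})(\mathrm{id}\otimes R)(R\otimes\mathrm{id})$. Let $TV$ be the tensor algebra and let $P(V)=\{p\in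 P(TV,TV):\pi(p)(V)\subset V\}$, a sub-bialgebra of $P(TV,TV)$. A measuring map $\sigma:C\to\mathrm{End}(TV)$ preserves $(V,R)$ if $\sigma(c)(V)\subset V$ and $R(\sigma\otimes\sigma)(\Delta(c))(v\otimes w)=(\sigma\otimes\sigma)(\Delta(c))R(v\otimes w)$ for all $c\in C$ and $v,w\in V$. The $R$-transformation algebra $P_R(V)$ is the unique maximal sub-bialgebra of $P(V)$ which preserves $(V,R)$ (with $\sigma$ the restriction of $\pi$). Let $R^*:V^*\otimes V^*\to V^*\otimes V^*$ be the dual map of $R$, with $V^*\otimes V^*$ identified with $(V\otimes V)^*$ by $(f\otimes f')(v\otimes w)=f(v)f'(w)$. The space $V^*\otimes V$ is a coalgebra with comultiplication $1\otimes u^*\otimes 1: V^*\otimes V\to V^*\otimes V\otimes V^*\otimes V$, arising from the unit $u$ of the algebra $\mathrm{End}(V)=V\otimes V^*$; explicitly $f\otimes v\mapsto\sum_i f\otimes e_i\otimes e^i\otimes v$ for a basis $(e_i)$ of $V$ with dual basis $(e^i)$. Its counit is evaluation $f\otimes v\mapsto f(v)$. This coalgebra structure extends uniquely to a bialgebra structure on the tensor algebra $T(V^*\otimes V)$. Let $\tau=1_{V^*}\otimes \mathrm{twist}\otimes 1_V$ be the map exchanging the middle two tensor factors (identifying $V^*\otimes V\otimes V^*\otimes V$ with $V^*\otimes V^*\otimes V\otimes V$ and back), and let $\alpha=\tau\circ(R^*\otimes 1_{V\otimes V})\circ\tau$ and $\beta=\tau\circ(1_{V^*\otimes V^*}\otimes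 R)\circ\tau$, as endomorphisms of $V^*\otimes V\otimes V^*\otimes V$. The FRT bialgebra is $A(R)=T(V^*\otimes V)/J$, where $J$ is the two-sided ideal (which is also a coideal) generated by $\mathrm{im}(\alpha-\beta)$.
   Formalization: The product on P(TV,TV) is taken from composition in diagrammatic order, π(pq)=π(q)∘π(p); with the usual order π(pq)=π(p)∘π(q) one gets P_R(V)=A(R)° without op, and the claim with op fails in general. *)

(* Defs.v *)
From HB Require Import structures.
From mathcomp Require Import all_boot all_order all_algebra.
From mathcomp Require Import boolp classical_sets reals.
From mathcomp Require Import complex.

Set Implicit Arguments.
Unset Strict Implicit.
Unset Printing Implicit Defensive.

Import GRing.Theory.

Local Open Scope ring_scope.
Local Open Scope quotient_scope.

Variant ground := RealGround | ComplexGround.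

Definition ground_field (F : realType) (g : ground) : fieldType :=
  match g with RealGround => F | ComplexGround => F[i] end.

(* Tensor product of two vector spaces: formal expressions in the symbols     *)
(* u (x) v, modulo the congruence generated by the laws of a vector space and *)
(* bilinearity.                                                               *)
Inductive tens_expr (K : fieldType) (U V : lmodType K) : Type :=
  | TPure of U & V
  | TAdd of tens_expr U V & tens_expr U V
  | TScale of K & tens_expr U V.
Arguments TPure {K U V}.

HB.instance Definition _ K U V := gen_eqMixin (@tens_expr K U V).
HB.instance Definition _ K U V := gen_choiceMixin (@tens_expr K U V).

Inductive tens_cong (K : fieldType) (U V : lmodType K) :
    tens_expr U V -> tens_expr U V -> Prop :=
  | tc_refl x : tens_cong x x
  | tc_sym x y : tens_cong x y -> tens_cong y x
  | tc_trans x y z : tens_cong x y -> tens_cong y z -> tens_cong x z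
  | tc_add x x' y y' : tens_cong x x' -> tens_cong y y' ->
      tens_cong (TAdd x y) (TAdd x' y')
  | tc_scale a x x' : tens_cong x x' -> tens_cong (TScale a x) (TScale a x')
  | tc_addA x y z : tens_cong (TAdd x (TAdd y z)) (TAdd (TAdd x y) z)
  | tc_addC x y : tens_cong (TAdd x y) (TAdd y x)
  | tc_add0 x : tens_cong (TAdd (TPure 0 0) x) x
  | tc_addN x : tens_cong (TAdd (TScale (-1) x) x) (TPure 0 0)
  | tc_scaleA a b x : tens_cong (TScale a (TScale b x)) (TScale (a * b) x)
  | tc_scale1 x : tens_cong (TScale 1 x) x
  | tc_scaleDr a x y :
      tens_cong (TScale a (TAdd x y)) (TAdd (TScale a x) (TScale a y))
  | tc_scaleDl a b x :
      tens_cong (TScale (a + b) x) (TAdd (TScale a x) (TScale b x))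
  | tc_pureDl u u' v :
      tens_cong (TPure (u + u') v) (TAdd (TPure u v) (TPure u' v))
  | tc_pureDr u v v' :
      tens_cong (TPure u (v + v')) (TAdd (TPure u v) (TPure u v'))
  | tc_pureZl a u v : tens_cong (TPure (a *: u) v) (TScale a (TPure u v))
  | tc_pureZr a u v : tens_cong (TPure u (a *: v)) (TScale a (TPure u v)).

Section TensorProduct.
Variables (K : fieldType) (U V : lmodType K).
Implicit Types x y z : tens_expr U V.

Definition tens_rel x y := `[< tens_cong x y >].

Fact tens_rel_refl : reflexive tens_rel.
Proof. by move=> x; apply/asboolP/tc_refl. Qed.
Fact tens_rel_sym : symmetric tens_rel.
Proof. by move=> x y; apply/asboolP/asboolP; apply: tc_sym. Qed.
Fact tens_rel_trans : transitive tens_rel.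
Proof. by move=> y x z /asboolP xy /asboolP yz; apply/asboolP/(tc_trans xy). Qed.

Canonical tens_equiv :=
  EquivRel tens_rel tens_rel_refl tens_rel_sym tens_rel_trans.

Definition tensor : Type := {eq_quot tens_equiv}.
HB.instance Definition _ := Choice.on tensor.
HB.instance Definition _ := Quotient.on tensor.

Lemma tens_eqP x y : tens_cong x y -> \pi_tensor x = \pi_tensor y.
Proof. by move=> xy; apply/eqquotP/asboolP. Qed.

Lemma tens_repr x : tens_cong (repr (\pi_tensor x)) x.
Proof. by apply/asboolP/(@eqquotP _ tens_equiv tensor); rewrite reprK. Qed.

Definition tens (u : U) (v : V) : tensor := \pi_tensor (TPure u v).
Definition tens_add (s t : tensor) : tensor := \pi_tensor (TAdd (repr s) (repr t)).
Definition tens_scale (a : K) (t : tensor) : tensor := \pi_tensor (TScale a (repr t)).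
Definition tens_opp (t : tensor) : tensor := tens_scale (-1) t.

Lemma tens_addE x y :
  tens_add (\pi_tensor x) (\pi_tensor y) = \pi_tensor (TAdd x y).
Proof. by apply: tens_eqP; apply: tc_add; apply: tens_repr. Qed.
Lemma tens_scaleE a x :
  tens_scale a (\pi_tensor x) = \pi_tensor (TScale a x).
Proof. by apply: tens_eqP; apply: tc_scale; apply: tens_repr. Qed.

Fact tens_addA : associative tens_add.
Proof.
elim/quotW=> x; elim/quotW=> y; elim/quotW=> z.
by rewrite (tens_addE y z) (tens_addE x y) !tens_addE; apply/tens_eqP/tc_addA.
Qed.
Fact tens_addC : commutative tens_add.
Proof.
by elim/quotW=> x; elim/quotW=> y; rewrite !tens_addE; apply/tens_eqP/tc_addC.
Qed.
Fact tens_add0 : left_id (tens 0 0) tens_add.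
Proof. by elim/quotW=> x; rewrite tens_addE; apply/tens_eqP/tc_add0. Qed.
Fact tens_addN : left_inverse (tens 0 0) tens_opp tens_add.
Proof.
by elim/quotW=> x; rewrite /tens_opp (tens_scaleE _ x) tens_addE; apply/tens_eqP/tc_addN.
Qed.
HB.instance Definition _ :=
  GRing.isZmodule.Build tensor tens_addA tens_addC tens_add0 tens_addN.

Fact tens_scaleA a b t : tens_scale a (tens_scale b t) = tens_scale (a * b) t.
Proof. by elim/quotW: t => x; rewrite (tens_scaleE b x) !tens_scaleE; apply/tens_eqP/tc_scaleA. Qed.
Fact tens_scale1 : left_id 1 tens_scale.
Proof. by elim/quotW=> x; rewrite tens_scaleE; apply/tens_eqP/tc_scale1. Qed.
Fact tens_scaleDr : right_distributive tens_scale +%R.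
Proof.
move=> a; elim/quotW=> x; elim/quotW=> y.
rewrite [_ + _]tens_addE !tens_scaleE [RHS]tens_addE.
by apply/tens_eqP/tc_scaleDr.
Qed.
Fact tens_scaleDl t : {morph tens_scale^~ t : a b / a + b}.
Proof.
move=> a b; elim/quotW: t => x.
by rewrite !tens_scaleE [RHS]tens_addE; apply/tens_eqP/tc_scaleDl.
Qed.
HB.instance Definition _ := GRing.Zmodule_isLmodule.Build K tensor
  tens_scaleA tens_scale1 tens_scaleDr tens_scaleDl.

Lemma tensDl u u' v : tens (u + u') v = tens u v + tens u' v.
Proof. by rewrite [RHS]tens_addE; apply/tens_eqP/tc_pureDl. Qed.
Lemma tensDr u v v' : tens u (v + v') = tens u v + tens u v'.
Proof. by rewrite [RHS]tens_addE; apply/tens_eqP/tc_pureDr. Qed.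
Lemma tensZl a u v : tens (a *: u) v = a *: tens u v.
Proof. by rewrite [RHS]tens_scaleE; apply/tens_eqP/tc_pureZl. Qed.
Lemma tensZr a u v : tens u (a *: v) = a *: tens u v.
Proof. by rewrite [RHS]tens_scaleE; apply/tens_eqP/tc_pureZr. Qed.

Lemma tens_ind (P : tensor -> Prop) :
  (forall u v, P (tens u v)) -> (forall s t, P s -> P t -> P (s + t)) ->
  (forall a t, P t -> P (a *: t)) -> forall t, P t.
Proof.
move=> Pp PD PZ; elim/quotW; elim=> [u v|x Px y Py|a x Px]; first exact: Pp.
  by have := PD _ _ Px Py; rewrite [X in P X -> _]tens_addE.
by have := PZ a _ Px; rewrite [X in P X -> _]tens_scaleE.
Qed.

End TensorProduct.

Notation "U ⊗ V" := (tensor U%type V%type)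
  (at level 40, left associativity) : type_scope.
Notation "u *t v" := (tens u v) (at level 40, left associativity) : ring_scope.

Section Lift.
Variables (K : fieldType) (U V W : lmodType K).
Implicit Types b : U -> V -> W.

Definition bilin b := (forall v, linear (b^~ v)) /\ (forall u, linear (b u)).

Fixpoint tens_eval b (x : tens_expr U V) : W :=
  match x with
  | TPure u v => b u v
  | TAdd x y => tens_eval b x + tens_eval b y
  | TScale a x => a *: tens_eval b x
  end.

(* The linear map u (x) v |-> b u v; only meaningful for bilinear b.          *)
Definition tlift b (t : U ⊗ V) : W := tens_eval b (repr t).

Section Bilinear.
Variable b : U -> V -> W.
Hypothesis bilin_b : bilin b.

Lemma bilinD2l u u' v : b (u + u') v = b u v + b u' v.
Proof. by have := bilin_b.1 v 1 u u'; rewrite /= !scale1r. Qed.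
Lemma bilinD2r u v v' : b u (v + v') = b u v + b u v'.
Proof. by have := bilin_b.2 u 1 v v'; rewrite !scale1r. Qed.
Lemma bilin0 v : b 0 v = 0.
Proof. by apply: (addrI (b 0 v)); rewrite -bilinD2l !addr0. Qed.
Lemma bilin0r u : b u 0 = 0.
Proof. by apply: (addrI (b u 0)); rewrite -bilinD2r !addr0. Qed.
Lemma bilinZ2l a u v : b (a *: u) v = a *: b u v.
Proof. by have := bilin_b.1 v a u 0; rewrite /= bilin0 !addr0. Qed.
Lemma bilinZ2r a u v : b u (a *: v) = a *: b u v.
Proof. by have := bilin_b.2 u a v 0; rewrite bilin0r !addr0. Qed.

Lemma tens_eval_cong x y : tens_cong x y -> tens_eval b x = tens_eval b y.
Proof.
elim=> //=.
- by move=> ? ? ? _ -> _ ->.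
- by move=> ? ? ? ? _ -> _ ->.
- by move=> ? ? ? _ ->.
- by move=> *; rewrite addrA.
- by move=> *; rewrite addrC.
- by move=> *; rewrite bilin0 add0r.
- by move=> *; rewrite bilin0 scaleN1r addNr.
- by move=> *; rewrite scalerA.
- by move=> *; rewrite scale1r.
- by move=> *; rewrite scalerDr.
- by move=> *; rewrite scalerDl.
- by move=> *; rewrite bilinD2l.
- by move=> *; rewrite bilinD2r.
- by move=> *; rewrite bilinZ2l.
- by move=> *; rewrite bilinZ2r.
Qed.

Lemma tlift_pi x : tlift b (\pi_(tensor U V) x) = tens_eval b x.
Proof. exact/tens_eval_cong/tens_repr. Qed.

Lemma tliftE u v : tlift b (u *t v) = b u v.
Proof. by rewrite tlift_pi. Qed.

Lemma tlift_linear : linear (tlift b).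
Proof.
move=> a; elim/quotW=> x; elim/quotW=> y.
by rewrite [a *: _]tens_scaleE [_ + _]tens_addE !tlift_pi.
Qed.
End Bilinear.

Lemma tens_ext (f g : U ⊗ V -> W) : linear f -> linear g ->
  (forall u v, f (u *t v) = g (u *t v)) -> f =1 g.
Proof.
move=> lf lg fg; elim/tens_ind => [u v|s t Hs Ht|a t Ht]; first exact: fg.
  by rewrite -[s]scale1r lf lg Hs Ht.
have f0 : f 0 = 0.
  by have := lf (-1) 0 0; rewrite scaler0 addr0 scaleN1r addNr.
have g0 : g 0 = 0.
  by have := lg (-1) 0 0; rewrite scaler0 addr0 scaleN1r addNr.
by have := lf a t 0; have := lg a t 0; rewrite !addr0 f0 g0 !addr0 Ht => -> ->.
Qed.

End Lift.

Section LiftTheory.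
Variable K : fieldType.

Lemma bilin_tens (U V : lmodType K) : bilin (@tens K U V).
Proof.
by split=> [v a u u'|u a v v']; rewrite /= ?tensDl ?tensZl ?tensDr ?tensZr.
Qed.

Lemma bilin_compl (U U' V W : lmodType K) (b : U -> V -> W) (f : U' -> U) :
  linear f -> bilin b -> bilin (fun u v => b (f u) v).
Proof.
move=> lf bb; split=> [v a u u'|u a v v'] /=; last exact: bb.2.
by rewrite lf (bb.1 v a).
Qed.

Lemma bilin_compr (U V V' W : lmodType K) (b : U -> V -> W) (f : V' -> V) :
  linear f -> bilin b -> bilin (fun u v => b u (f v)).
Proof.
move=> lf bb; split=> [v a u u'|u a v v'] /=; first exact: bb.1.
by rewrite lf bb.2.
Qed.

Lemma bilin_comp (U V W W' : lmodType K) (b : U -> V -> W) (f : W -> W') :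
  linear f -> bilin b -> bilin (fun u v => f (b u v)).
Proof.
move=> lf bb; split=> [v a u u'|u a v v'] /=; first by rewrite (bb.1 v a) lf.
by rewrite bb.2 lf.
Qed.

Lemma bilinC (U V W : lmodType K) (b : U -> V -> W) :
  bilin b -> bilin (fun v u => b u v).
Proof. by case. Qed.

Lemma tlift_bilin (U V W X : lmodType K) (b : X -> U -> V -> W) :
  (forall x, bilin (b x)) -> (forall u v, linear (fun x => b x u v)) ->
  bilin (fun t x => tlift (b x) t).
Proof.
move=> bb lb; split=> [x|t a x y]; first exact: tlift_linear.
elim/tens_ind: t => [u v|s t Hs Ht|c t Ht].
- by rewrite !tliftE ?lb.
- have D z : tlift (b z) (s + t) = tlift (b z) s + tlift (b z) t.
    by rewrite -{1}[s]scale1r (tlift_linear (bb z)) scale1r.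
  by rewrite !D Hs Ht scalerDr addrACA.
have Z z : tlift (b z) (c *: t) = c *: tlift (b z) t.
  have l := tlift_linear (bb z).
  have f0 : tlift (b z) 0 = 0.
    by have := l (-1) 0 0; rewrite scaler0 addr0 scaleN1r addNr.
  by have := l c t 0; rewrite f0 !addr0.
by rewrite !Z Ht scalerDr !scalerA mulrC.
Qed.

Definition tmap (U V U' V' : lmodType K) (f : U -> U') (g : V -> V') :
  U ⊗ V -> U' ⊗ V' := tlift (fun u v => f u *t g v).

Definition tassoc (U V W : lmodType K) : (U ⊗ V) ⊗ W -> U ⊗ (V ⊗ W) :=
  tlift (fun s w => tlift (fun u v => u *t (v *t w)) s).

Definition tassocV (U V W : lmodType K) : U ⊗ (V ⊗ W) -> (U ⊗ V) ⊗ W :=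
  tlift (fun u t => tlift (fun v w => (u *t v) *t w) t).

Definition tmid (U V U' V' : lmodType K) :
    (U ⊗ V) ⊗ (U' ⊗ V') -> (U ⊗ U') ⊗ (V ⊗ V') :=
  tlift (fun s t =>
    tlift (fun u v => tlift (fun u' v' => (u *t u') *t (v *t v')) t) s).

Section Maps.
Variables U V U' V' : lmodType K.

Lemma bilin_tmap (f : {linear U -> U'}) (g : {linear V -> V'}) :
  bilin (fun u v => f u *t g v).
Proof.
by split=> [v a u u'|u a v v'] /=; rewrite linearP !(tensDl, tensZl, tensDr, tensZr).
Qed.

Lemma tmapE (f : {linear U -> U'}) (g : {linear V -> V'}) u v :
  tmap f g (u *t v) = f u *t g v.
Proof. exact: (tliftE (bilin_tmap f g)). Qed.

HB.instance Definition _ (f : {linear U -> U'}) (g : {linear V -> V'}) :=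
  GRing.isLinear.Build K _ _ _ (tmap f g)
    (tlift_linear (bilin_tmap f g)).

Lemma bilin_tassoc_in (w : V') :
  bilin (fun (u : U) (v : V) => u *t (v *t w)).
Proof.
by split=> [v a u u'|u a v v'] /=;
  rewrite ?tensDl ?tensZl ?tensDr ?tensZr.
Qed.
Lemma bilin_tassoc : 
  bilin (fun (s : U ⊗ V) (w : V') => tlift (fun u v => u *t (v *t w)) s).
Proof.
apply: tlift_bilin => [w|u v a w w']; first exact: bilin_tassoc_in.
by rewrite !(tensDr, tensZr).
Qed.
Lemma tassocE (u : U) (v : V) (w : V') :
  tassoc ((u *t v) *t w) = u *t (v *t w).
Proof.
rewrite /tassoc (tliftE bilin_tassoc).
exact: (tliftE (bilin_tassoc_in w)).
Qed.
HB.instance Definition _ :=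
  GRing.isLinear.Build K _ _ _ (@tassoc U V V') (tlift_linear bilin_tassoc).

Lemma bilin_tassocV_in (u : U) :
  bilin (fun (v : V) (w : V') => (u *t v) *t w).
Proof.
by split=> [v a w w'|v a w w'] /=; rewrite !(tensDl, tensZl, tensDr, tensZr).
Qed.
Lemma bilin_tassocV : 
  bilin (fun (u : U) (t : V ⊗ V') => tlift (fun v w => (u *t v) *t w) t).
Proof.
apply: bilinC; apply: tlift_bilin => [u|v w a u u']; first exact: bilin_tassocV_in.
by rewrite !(tensDl, tensZl).
Qed.
Lemma tassocVE (u : U) (v : V) (w : V') :
  tassocV (u *t (v *t w)) = (u *t v) *t w.
Proof.
rewrite /tassocV (tliftE bilin_tassocV).
exact: (tliftE (bilin_tassocV_in u)).
Qed.
HB.instance Definition _ :=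
  GRing.isLinear.Build K _ _ _ (@tassocV U V V') (tlift_linear bilin_tassocV).

Lemma bilin_tmid2 (u : U) (v : V) :
  bilin (fun (u' : U') (v' : V') => (u *t u') *t (v *t v')).
Proof.
by split=> [x a y z|x a y z] /=; rewrite !(tensDl, tensZl, tensDr, tensZr).
Qed.
Lemma bilin_tmid1 (t : U' ⊗ V') :
  bilin (fun (u : U) (v : V) =>
    tlift (fun u' v' => (u *t u') *t (v *t v')) t).
Proof.
split=> [v|u].
  apply: (tlift_bilin _ _).2 => [u|u' v' a x y]; first exact: bilin_tmid2.
  by rewrite !(tensDl, tensZl, tensDr, tensZr).
apply: (tlift_bilin _ _).2 => [v|u' v' a x y]; first exact: bilin_tmid2.
by rewrite !(tensDl, tensZl, tensDr, tensZr).
Qed.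
Lemma bilin_tmid : bilin (fun (s : U ⊗ V) (t : U' ⊗ V') =>
    tlift (fun u v => tlift (fun u' v' => (u *t u') *t (v *t v')) t) s).
Proof.
apply: tlift_bilin => [t|u v]; first exact: bilin_tmid1.
exact/tlift_linear/bilin_tmid2.
Qed.
Lemma tmidE (u : U) (v : V) (u' : U') (v' : V') :
  tmid ((u *t v) *t (u' *t v')) = (u *t u') *t (v *t v').
Proof.
rewrite /tmid (tliftE bilin_tmid) (tliftE (bilin_tmid1 _)).
exact: (tliftE (bilin_tmid2 _ _)).
Qed.
HB.instance Definition _ :=
  GRing.isLinear.Build K _ _ _ (@tmid U V U' V') (tlift_linear bilin_tmid).
End Maps.

End LiftTheory.

Section Retraction.
Variables (K : fieldType) (U V : lmodType K) (i : {linear U -> V}).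
Hypothesis i_inj : injective i.

Let indep (X : set V) := (forall a u v, X u -> X v -> X (a *: u + v)) /\
  (forall u, X (i u) -> u = 0).

Lemma retraction : exists r : {linear V -> U}, cancel i r.
Proof.
have i0 u : i u = 0 -> u = 0 by rewrite -{1}(linear0 i) => /i_inj.
have [|X [[XD Xi] Xmax]] := @Zorn_bigcup _ indep.
  move=> F FP Ftot; split=> [a u v [X FX Xu] [Y FY Yv]|u [X FX Xu]]; last first.
    exact: (FP _ FX).2.
  have [XY|YX] := Ftot X Y FX FY.
    by exists Y => //; apply: (FP _ FY).1 => //; apply: XY.
  by exists X => //; apply: (FP _ FX).1 => //; apply: YX.
have X0 : X 0.
  apply: contrapT => nX0; apply: (Xmax [set 0]%classic); last first.
    split=> [a u v -> ->|u /= /i0 //]; by rewrite /= scaler0 addr0.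
  split=> [u Xu|/(_ 0 erefl)//]; exfalso; apply: nX0.
  by have := XD (-1) _ _ Xu Xu; rewrite scaleN1r addNr.
have XN x : X x -> X (- x).
  by move=> Xx; have := XD (-1) _ _ Xx X0; rewrite scaleN1r addr0.
have XZ a x : X x -> X (a *: x).
  by move=> Xx; have := XD a _ _ Xx X0; rewrite addr0.
have Xdec v : exists u, X (v - i u).
  apply: contrapT => nX.
  pose Y : set V := fun w => exists a x, X x /\ w = a *: v + x.
  apply: (Xmax Y); split.
  - by move=> x Xx; exists 0, x; split=> //; rewrite scale0r add0r.
  - move=> sYX; apply: nX; exists 0; rewrite linear0 subr0; apply: sYX.
    by exists 1, 0; split=> //; rewrite scale1r addr0.
  - move=> a _ _ [b [x [Xx ->]]] [c [y [Xy ->]]].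
    exists (a * b + c), (a *: x + y); split; first exact: XD.
    by rewrite scalerDr scalerDl scalerA addrACA.
  - move=> u [a [x [Xx e]]]; have [a0|a0] := eqVneq a 0.
      by apply: Xi; rewrite e a0 scale0r add0r.
    exfalso; apply: nX; exists (a^-1 *: u).
    rewrite linearZ /= e scalerDr scalerA mulVf // scale1r opprD addrA subrr add0r.
    exact/XN/XZ.
pose r v := projT1 (cid (Xdec v)).
have rP v : X (v - i (r v)) by rewrite /r; case: cid.
have runiq v u : X (v - i u) -> r v = u.
  move=> Xu; apply/eqP; rewrite -subr_eq0; apply/eqP/Xi.
  have := XD (-1) _ _ (rP v) Xu; rewrite scaleN1r opprB linearB /=.
  by rewrite addrA subrK.
have lr : linear r.
  move=> a u v; apply: runiq; have := XD a _ _ (rP u) (rP v).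
  by rewrite linearP scalerBr opprD addrACA.
pose m := GRing.isLinear.Build K V U _ r lr.
pose R : {linear V -> U} := HB.pack r m.
exists R => u; apply: runiq; by rewrite subrr.
Qed.
End Retraction.

Section TensorAlgebraStructure.
Variables (K : fieldType) (A B : algType K).

Definition tmul (s t : A ⊗ B) : A ⊗ B :=
  tlift (fun a b => tlift (fun a' b' => (a * a') *t (b * b')) t) s.

Lemma bilin_tmul2 (a : A) (b : B) :
  bilin (fun (a' : A) (b' : B) => (a * a') *t (b * b')).
Proof.
by split=> [x c y z|x c y z] /=;
  rewrite !(mulrDr, =^~ scalerAr, tensDl, tensZl, tensDr, tensZr).
Qed.
Lemma bilin_tmul1 (t : A ⊗ B) :
  bilin (fun (a : A) (b : B) => tlift (fun a' b' => (a * a') *t (b * b')) t).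
Proof.
split=> [b|a].
  apply: (tlift_bilin _ _).2 => [a|a' b' c x y]; first exact: bilin_tmul2.
  by rewrite !(mulrDl, =^~ scalerAl, tensDl, tensZl).
apply: (tlift_bilin _ _).2 => [b|a' b' c x y]; first exact: bilin_tmul2.
by rewrite !(mulrDl, =^~ scalerAl, tensDr, tensZr).
Qed.
Lemma bilin_tmul : bilin tmul.
Proof.
apply: tlift_bilin => [t|u v]; first exact: bilin_tmul1.
exact/tlift_linear/bilin_tmul2.
Qed.
Lemma tmulE a b a' b' : tmul (a *t b) (a' *t b') = (a * a') *t (b * b').
Proof.
by rewrite /tmul (tliftE (bilin_tmul1 _)) (tliftE (bilin_tmul2 _ _)).
Qed.

Fact tmulA : associative tmul.
Proof.
have Dl := bilinD2l bilin_tmul; have Dr := bilinD2r bilin_tmul.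
have Zl := bilinZ2l bilin_tmul; have Zr := bilinZ2r bilin_tmul.
elim/tens_ind=> [a b|s t Hs Ht|c s Hs] x y; last 2 first.
- by rewrite !Dl Hs Ht.
- by rewrite !Zl Hs.
elim/tens_ind: x => [a' b'|s t Hs Ht|c s Hs]; last 2 first.
- by rewrite !(Dl, Dr) Hs Ht.
- by rewrite !(Zl, Zr) Hs.
elim/tens_ind: y => [a'' b''|s t Hs Ht|c s Hs]; last 2 first.
- by rewrite !Dr Hs Ht.
- by rewrite !Zr Hs.
by rewrite !tmulE !mulrA.
Qed.
Fact tmul1l : left_id (1 *t 1) tmul.
Proof.
elim/tens_ind=> [a b|s t Hs Ht|c s Hs].
- by rewrite tmulE !mul1r.
- by rewrite (bilinD2r bilin_tmul) Hs Ht.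
- by rewrite (bilinZ2r bilin_tmul) Hs.
Qed.
Fact tmul1r : right_id (1 *t 1) tmul.
Proof.
elim/tens_ind=> [a b|s t Hs Ht|c s Hs].
- by rewrite tmulE !mulr1.
- by rewrite (bilinD2l bilin_tmul) Hs Ht.
- by rewrite (bilinZ2l bilin_tmul) Hs.
Qed.
Fact tmulDl : left_distributive tmul +%R.
Proof. by move=> s t u; rewrite (bilinD2l bilin_tmul). Qed.
Fact tmulDr : right_distributive tmul +%R.
Proof. by move=> s t u; rewrite (bilinD2r bilin_tmul). Qed.

Lemma unit_functional (C : algType K) : exists r : {linear C -> K^o}, r 1 = 1.
Proof.
have lin : linear (fun a : K^o => a%:A : C).
  by move=> a x y; rewrite scalerDl scalerA.
pose m := GRing.isLinear.Build K K^o C _ _ lin.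
pose f : {linear K^o -> C} := HB.pack (fun a : K^o => a%:A : C) m.
have f_inj : injective f.
  move=> x y /= /eqP; rewrite -subr_eq0 -scalerBl scaler_eq0 oner_eq0 orbF.
  by rewrite subr_eq0 => /eqP.
by have [r rf] := retraction f_inj; exists r; rewrite -(rf 1) /= scale1r.
Qed.

Fact tone_neq0 : (1 : A) *t (1 : B) != 0.
Proof.
have [r r1] := unit_functional A; have [s s1] := unit_functional B.
have bb : bilin (fun a b => r a * s b : K^o).
  by split=> [b c x y|a c x y] /=;
    rewrite linearP !(mulrDl, mulrDr, =^~ scalerAl, =^~ scalerAr).
apply/eqP => /(congr1 (tlift (fun a b => r a * s b : K^o))).
rewrite (tliftE bb) r1 s1 mulr1 => /eqP.
suff -> : tlift (fun a b => r a * s b : K^o) 0 = 0 by rewrite oner_eq0.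
by have := tlift_linear bb (-1) 0 0; rewrite scaler0 addr0 scaleN1r addNr.
Qed.

HB.instance Definition _ := GRing.Zmodule_isNzRing.Build (A ⊗ B)%type
  tmulA tmul1l tmul1r tmulDl tmulDr tone_neq0.

Fact tscaleAl (a : K) (s t : A ⊗ B) : a *: (s * t) = (a *: s) * t.
Proof. by rewrite [RHS](bilinZ2l bilin_tmul). Qed.
HB.instance Definition _ := GRing.Lmodule_isLalgebra.Build K (A ⊗ B)%type tscaleAl.
Fact tscaleAr (a : K) (s t : A ⊗ B) : a *: (s * t) = s * (a *: t).
Proof. by rewrite [RHS](bilinZ2r bilin_tmul). Qed.
HB.instance Definition _ := GRing.Lalgebra_isAlgebra.Build K (A ⊗ B)%type tscaleAr.

Lemma tens_mulE (a a' : A) (b b' : B) : (a *t b) * (a' *t b') = (a * a') *t (b * b').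
Proof. exact: tmulE. Qed.
End TensorAlgebraStructure.

(* Tensor algebra: noncommutative polynomial expressions in the elements of   *)
(* V, modulo the congruence generated by the laws of a K-algebra and the      *)
(* linearity of the inclusion of V.                                           *)
Inductive talg_expr (K : fieldType) (V : lmodType K) : Type :=
  | AGen of V
  | AOne
  | AAdd of talg_expr V & talg_expr V
  | AScale of K & talg_expr V
  | AMul of talg_expr V & talg_expr V.
Arguments AGen {K V}.
Arguments AOne {K V}.

HB.instance Definition _ K V := gen_eqMixin (@talg_expr K V).
HB.instance Definition _ K V := gen_choiceMixin (@talg_expr K V).

Inductive talg_cong (K : fieldType) (V : lmodType K) :
    talg_expr V -> talg_expr V -> Prop :=
  | ac_refl x : talg_cong x x
  | ac_sym x y : talg_cong x y -> talg_cong y x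
  | ac_trans x y z : talg_cong x y -> talg_cong y z -> talg_cong x z
  | ac_add x x' y y' : talg_cong x x' -> talg_cong y y' ->
      talg_cong (AAdd x y) (AAdd x' y')
  | ac_scale a x x' : talg_cong x x' -> talg_cong (AScale a x) (AScale a x')
  | ac_mul x x' y y' : talg_cong x x' -> talg_cong y y' ->
      talg_cong (AMul x y) (AMul x' y')
  | ac_addA x y z : talg_cong (AAdd x (AAdd y z)) (AAdd (AAdd x y) z)
  | ac_addC x y : talg_cong (AAdd x y) (AAdd y x)
  | ac_add0 x : talg_cong (AAdd (AGen 0) x) x
  | ac_addN x : talg_cong (AAdd (AScale (-1) x) x) (AGen 0)
  | ac_scaleA a b x : talg_cong (AScale a (AScale b x)) (AScale (a * b) x)
  | ac_scale1 x : talg_cong (AScale 1 x) x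
  | ac_scaleDr a x y :
      talg_cong (AScale a (AAdd x y)) (AAdd (AScale a x) (AScale a y))
  | ac_scaleDl a b x :
      talg_cong (AScale (a + b) x) (AAdd (AScale a x) (AScale b x))
  | ac_mulA x y z : talg_cong (AMul x (AMul y z)) (AMul (AMul x y) z)
  | ac_mul1l x : talg_cong (AMul AOne x) x
  | ac_mul1r x : talg_cong (AMul x AOne) x
  | ac_mulDl x y z : talg_cong (AMul (AAdd x y) z) (AAdd (AMul x z) (AMul y z))
  | ac_mulDr x y z : talg_cong (AMul x (AAdd y z)) (AAdd (AMul x y) (AMul x z))
  | ac_scaleAl a x y : talg_cong (AScale a (AMul x y)) (AMul (AScale a x) y)
  | ac_scaleAr a x y : talg_cong (AScale a (AMul x y)) (AMul x (AScale a y))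
  | ac_genD u v : talg_cong (AGen (u + v)) (AAdd (AGen u) (AGen v))
  | ac_genZ a v : talg_cong (AGen (a *: v)) (AScale a (AGen v)).

Section TensorAlgebra.
Variables (K : fieldType) (V : lmodType K).
Implicit Types x y z : talg_expr V.

Fixpoint talg_eval (A : algType K) (f : V -> A) x : A :=
  match x with
  | AGen v => f v
  | AOne => 1
  | AAdd x y => talg_eval f x + talg_eval f y
  | AScale a x => a *: talg_eval f x
  | AMul x y => talg_eval f x * talg_eval f y
  end.

Lemma talg_eval_cong (A : algType K) (f : {linear V -> A}) x y :
  talg_cong x y -> talg_eval f x = talg_eval f y.
Proof.
elim=> //=.
- by move=> ? ? ? _ -> _ ->.
- by move=> ? ? ? ? _ -> _ ->.
- by move=> ? ? ? _ ->.
- by move=> ? ? ? ? _ -> _ ->.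
- by move=> *; rewrite addrA.
- by move=> *; rewrite addrC.
- by move=> *; rewrite linear0 add0r.
- by move=> *; rewrite linear0 scaleN1r addNr.
- by move=> *; rewrite scalerA.
- by move=> *; rewrite scale1r.
- by move=> *; rewrite scalerDr.
- by move=> *; rewrite scalerDl.
- by move=> *; rewrite mulrA.
- by move=> *; rewrite mul1r.
- by move=> *; rewrite mulr1.
- by move=> *; rewrite mulrDl.
- by move=> *; rewrite mulrDr.
- by move=> *; rewrite scalerAl.
- by move=> *; rewrite scalerAr.
- by move=> *; rewrite linearD.
- by move=> *; rewrite linearZ.
Qed.

Definition talg_rel x y := `[< talg_cong x y >].
Fact talg_rel_refl : reflexive talg_rel.
Proof. by move=> x; apply/asboolP/ac_refl. Qed.
Fact talg_rel_sym : symmetric talg_rel.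
Proof. by move=> x y; apply/asboolP/asboolP; apply: ac_sym. Qed.
Fact talg_rel_trans : transitive talg_rel.
Proof. by move=> y x z /asboolP xy /asboolP yz; apply/asboolP/(ac_trans xy). Qed.
Canonical talg_equiv :=
  EquivRel talg_rel talg_rel_refl talg_rel_sym talg_rel_trans.

Definition talg : Type := {eq_quot talg_equiv}.
HB.instance Definition _ := Choice.on talg.
HB.instance Definition _ := Quotient.on talg.

Lemma talg_eqP x y : talg_cong x y -> \pi_talg x = \pi_talg y.
Proof. by move=> xy; apply/eqquotP/asboolP. Qed.
Lemma talg_repr x : talg_cong (repr (\pi_talg x)) x.
Proof. by apply/asboolP/(@eqquotP _ talg_equiv talg); rewrite reprK. Qed.

Definition tgen (v : V) : talg := \pi_talg (AGen v).
Definition talg_one : talg := \pi_talg AOne.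
Definition talg_add (s t : talg) : talg := \pi_talg (AAdd (repr s) (repr t)).
Definition talg_mul (s t : talg) : talg := \pi_talg (AMul (repr s) (repr t)).
Definition talg_scale (a : K) (t : talg) : talg := \pi_talg (AScale a (repr t)).
Definition talg_opp (t : talg) : talg := talg_scale (-1) t.

Lemma talg_addE x y :
  talg_add (\pi_talg x) (\pi_talg y) = \pi_talg (AAdd x y).
Proof. by apply: talg_eqP; apply: ac_add; apply: talg_repr. Qed.
Lemma talg_mulE x y :
  talg_mul (\pi_talg x) (\pi_talg y) = \pi_talg (AMul x y).
Proof. by apply: talg_eqP; apply: ac_mul; apply: talg_repr. Qed.
Lemma talg_scaleE a x : talg_scale a (\pi_talg x) = \pi_talg (AScale a x).
Proof. by apply: talg_eqP; apply: ac_scale; apply: talg_repr. Qed.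

Fact talg_addA : associative talg_add.
Proof.
elim/quotW=> x; elim/quotW=> y; elim/quotW=> z.
by rewrite (talg_addE y z) (talg_addE x y) !talg_addE; apply/talg_eqP/ac_addA.
Qed.
Fact talg_addC : commutative talg_add.
Proof.
by elim/quotW=> x; elim/quotW=> y; rewrite !talg_addE; apply/talg_eqP/ac_addC.
Qed.
Fact talg_add0 : left_id (tgen 0) talg_add.
Proof. by elim/quotW=> x; rewrite talg_addE; apply/talg_eqP/ac_add0. Qed.
Fact talg_addN : left_inverse (tgen 0) talg_opp talg_add.
Proof.
elim/quotW=> x; rewrite /talg_opp (talg_scaleE _ x) talg_addE.
exact/talg_eqP/ac_addN.
Qed.
HB.instance Definition _ :=
  GRing.isZmodule.Build talg talg_addA talg_addC talg_add0 talg_addN.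

Fact talg_scaleA a b t : talg_scale a (talg_scale b t) = talg_scale (a * b) t.
Proof.
elim/quotW: t => x; rewrite (talg_scaleE b x) !talg_scaleE.
exact/talg_eqP/ac_scaleA.
Qed.
Fact talg_scale1 : left_id 1 talg_scale.
Proof. by elim/quotW=> x; rewrite talg_scaleE; apply/talg_eqP/ac_scale1. Qed.
Fact talg_scaleDr : right_distributive talg_scale +%R.
Proof.
move=> a; elim/quotW=> x; elim/quotW=> y.
rewrite [_ + _]talg_addE !talg_scaleE [RHS]talg_addE.
exact/talg_eqP/ac_scaleDr.
Qed.
Fact talg_scaleDl t : {morph talg_scale^~ t : a b / a + b}.
Proof.
move=> a b; elim/quotW: t => x.
by rewrite !talg_scaleE [RHS]talg_addE; apply/talg_eqP/ac_scaleDl.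
Qed.
HB.instance Definition _ := GRing.Zmodule_isLmodule.Build K talg
  talg_scaleA talg_scale1 talg_scaleDr talg_scaleDl.

Fact talg_mulA : associative talg_mul.
Proof.
elim/quotW=> x; elim/quotW=> y; elim/quotW=> z.
by rewrite (talg_mulE y z) (talg_mulE x y) !talg_mulE; apply/talg_eqP/ac_mulA.
Qed.
Fact talg_mul1l : left_id talg_one talg_mul.
Proof. by elim/quotW=> x; rewrite talg_mulE; apply/talg_eqP/ac_mul1l. Qed.
Fact talg_mul1r : right_id talg_one talg_mul.
Proof. by elim/quotW=> x; rewrite talg_mulE; apply/talg_eqP/ac_mul1r. Qed.
Fact talg_mulDl : left_distributive talg_mul +%R.
Proof.
elim/quotW=> x; elim/quotW=> y; elim/quotW=> z.
rewrite [X in talg_mul X _]talg_addE !talg_mulE [RHS]talg_addE.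
exact/talg_eqP/ac_mulDl.
Qed.
Fact talg_mulDr : right_distributive talg_mul +%R.
Proof.
elim/quotW=> x; elim/quotW=> y; elim/quotW=> z.
rewrite [X in talg_mul _ X]talg_addE !talg_mulE [RHS]talg_addE.
exact/talg_eqP/ac_mulDr.
Qed.

Definition talg_lift (A : algType K) (f : V -> A) (t : talg) : A :=
  talg_eval f (repr t).

Lemma talg_lift_pi (A : algType K) (f : {linear V -> A}) x :
  talg_lift f (\pi_talg x) = talg_eval f x.
Proof. exact/talg_eval_cong/talg_repr. Qed.

Fact talg_one_neq0 : talg_one != tgen 0.
Proof.
apply/eqP => /(congr1 (talg_lift (\0 : {linear V -> K^o}))).
by rewrite !talg_lift_pi /= => /eqP; rewrite oner_eq0.
Qed.
HB.instance Definition _ := GRing.Zmodule_isNzRing.Build talg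
  talg_mulA talg_mul1l talg_mul1r talg_mulDl talg_mulDr talg_one_neq0.

Fact talg_scaleAl (a : K) (s t : talg) : a *: (s * t) = (a *: s) * t.
Proof.
elim/quotW: s => x; elim/quotW: t => y.
rewrite [_ * _]talg_mulE [X in _ = X * _]talg_scaleE [LHS]talg_scaleE.
by rewrite [RHS]talg_mulE; apply/talg_eqP/ac_scaleAl.
Qed.
HB.instance Definition _ := GRing.Lmodule_isLalgebra.Build K talg talg_scaleAl.
Fact talg_scaleAr (a : K) (s t : talg) : a *: (s * t) = s * (a *: t).
Proof.
elim/quotW: s => x; elim/quotW: t => y.
rewrite [_ * _]talg_mulE [X in _ = _ * X]talg_scaleE [LHS]talg_scaleE.
by rewrite [RHS]talg_mulE; apply/talg_eqP/ac_scaleAr.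
Qed.
HB.instance Definition _ := GRing.Lalgebra_isAlgebra.Build K talg talg_scaleAr.

Fact tgen_linear : linear tgen.
Proof.
move=> a u v; rewrite [X in _ = X + _]talg_scaleE [RHS]talg_addE.
apply/talg_eqP/(ac_trans (ac_genD _ _))/ac_add; first exact: ac_genZ.
exact: ac_refl.
Qed.
HB.instance Definition _ := GRing.isLinear.Build K V talg _ tgen tgen_linear.

Lemma talg_ind (P : talg -> Prop) :
  (forall v, P (tgen v)) -> P 1 -> (forall s t, P s -> P t -> P (s + t)) ->
  (forall a t, P t -> P (a *: t)) -> (forall s t, P s -> P t -> P (s * t)) ->
  forall t, P t.
Proof.
move=> Pg P1 PD PZ PM; elim/quotW; elim=> //.
- by move=> x Px y Py; have := PD _ _ Px Py; rewrite [X in P X -> _]talg_addE.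
- by move=> a x Px; have := PZ a _ Px; rewrite [X in P X -> _]talg_scaleE.
- by move=> x Px y Py; have := PM _ _ Px Py; rewrite [X in P X -> _]talg_mulE.
Qed.

Section TalgLift.
Variables (A : algType K) (f : {linear V -> A}).

Lemma talg_lift_gen v : talg_lift f (tgen v) = f v.
Proof. exact: talg_lift_pi. Qed.

Fact talg_lift_linear : linear (talg_lift f).
Proof.
move=> a; elim/quotW=> x; elim/quotW=> y.
by rewrite [a *: _]talg_scaleE [_ + _]talg_addE !talg_lift_pi.
Qed.
Fact talg_lift_monoid : monoid_morphism (talg_lift f).
Proof.
split; first exact: talg_lift_pi.
elim/quotW=> x; elim/quotW=> y.
by rewrite [_ * _]talg_mulE !talg_lift_pi.
Qed.
HB.instance Definition _ :=
  GRing.isLinear.Build K talg A _ (talg_lift f) talg_lift_linear.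
HB.instance Definition _ :=
  GRing.isMonoidMorphism.Build talg A (talg_lift f) talg_lift_monoid.
End TalgLift.

Lemma talg_ext (A : algType K) (f g : {lrmorphism talg -> A}) :
  (forall v, f (tgen v) = g (tgen v)) -> f =1 g.
Proof.
move=> fg; elim/talg_ind=> [//||s t Hs Ht|a t Ht|s t Hs Ht].
- by rewrite !rmorph1.
- by rewrite !rmorphD /= Hs Ht.
- by rewrite !linearZ /= Ht.
- by rewrite !rmorphM /= Hs Ht.
Qed.

End TensorAlgebra.

Section Contraction.
Variables (K : fieldType) (U V : lmodType K).

Definition contractl (f : U -> K^o) : U ⊗ V -> V := tlift (fun u v => f u *: v).
Definition contractr (g : V -> K^o) : U ⊗ V -> U := tlift (fun u v => g v *: u).

Lemma bilin_contractl (f : {linear U -> K^o}) : bilin (fun u (v : V) => f u *: v).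
Proof.
by split=> [v a x y|u a x y] /=;
  rewrite ?linearP ?(scalerDl, scalerDr, scalerA) // [f u * a]mulrC.
Qed.
Lemma bilin_contractr (g : {linear V -> K^o}) : bilin (fun (u : U) v => g v *: u).
Proof.
by split=> [v a x y|u a x y] /=;
  rewrite ?linearP ?(scalerDl, scalerDr, scalerA) // [g v * a]mulrC.
Qed.
Lemma contractlE (f : {linear U -> K^o}) u (v : V) :
  contractl f (u *t v) = f u *: v.
Proof. exact: (tliftE (bilin_contractl f)). Qed.
Lemma contractrE (g : {linear V -> K^o}) (u : U) v :
  contractr g (u *t v) = g v *: u.
Proof. exact: (tliftE (bilin_contractr g)). Qed.
HB.instance Definition _ (f : {linear U -> K^o}) :=
  GRing.isLinear.Build K _ _ _ (contractl f) (tlift_linear (bilin_contractl f)).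
HB.instance Definition _ (g : {linear V -> K^o}) :=
  GRing.isLinear.Build K _ _ _ (contractr g) (tlift_linear (bilin_contractr g)).
End Contraction.

Section Functoriality.
Variable K : fieldType.

Lemma eq_tmap (U V U' V' : lmodType K) (f f' : U -> U') (g g' : V -> V') :
  f =1 f' -> g =1 g' -> tmap f g =1 tmap f' g'.
Proof. by move=> /funext -> /funext ->. Qed.

Lemma tmap_comp (U V U' V' U'' V'' : lmodType K)
    (f : {linear U' -> U''}) (g : {linear V' -> V''})
    (f' : {linear U -> U'}) (g' : {linear V -> V'}) t :
  tmap f g (tmap f' g' t) = tmap (f \o f') (g \o g') t.
Proof.
move: t; apply: tens_ext => [a x y|a x y|u v]; rewrite ?linearP //.
by rewrite !tmapE.
Qed.

Lemma tassoc_nat (U V W U' V' W' : lmodType K) (f : {linear U -> U'})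
    (g : {linear V -> V'}) (h : {linear W -> W'}) t :
  tassoc (tmap (tmap f g) h t) = tmap f (tmap g h) (tassoc t).
Proof.
move: t; apply: tens_ext => [a x y|a x y|s w]; rewrite ?linearP // tmapE.
move: s; apply: tens_ext => [a x y|a x y|u v].
- by rewrite linearP tensDl tensZl linearP.
- by rewrite tensDl tensZl !linearP.
by rewrite /= tmapE !tassocE !tmapE /= tmapE.
Qed.

Lemma contractl_tmap (U V U' V' : lmodType K) (e : {linear U' -> K^o})
    (f : {linear U -> U'}) (g : {linear V -> V'}) t :
  contractl e (tmap f g t) = g (contractl (e \o f) t).
Proof.
move: t; apply: tens_ext => [a x y|a x y|u v]; rewrite ?linearP //.
by rewrite tmapE !contractlE linearZ.
Qed.
Lemma contractr_tmap (U V U' V' : lmodType K) (e : {linear V' -> K^o})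
    (f : {linear U -> U'}) (g : {linear V -> V'}) t :
  contractr e (tmap f g t) = f (contractr (e \o g) t).
Proof.
move: t; apply: tens_ext => [a x y|a x y|u v]; rewrite ?linearP //.
by rewrite tmapE !contractrE linearZ.
Qed.
Lemma eq_contractl (U V : lmodType K) (e e' : U -> K^o) :
  e =1 e' -> @contractl K U V e =1 contractl e'.
Proof. by move=> /funext ->. Qed.
Lemma eq_contractr (U V : lmodType K) (e e' : V -> K^o) :
  e =1 e' -> @contractr K U V e =1 contractr e'.
Proof. by move=> /funext ->. Qed.
End Functoriality.

HB.mixin Record Lmodule_isCoalgebra (K : fieldType) C of GRing.Lmodule K C := {
  comul_subdef : {linear C -> C ⊗ C};
  counit_subdef : {linear C -> K^o};
  comulA_subproof : forall c : C,
    tassoc (tmap comul_subdef idfun (comul_subdef c)) =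
      tmap idfun comul_subdef (comul_subdef c);
  counitl_subproof : forall c : C, contractl counit_subdef (comul_subdef c) = c;
  counitr_subproof : forall c : C, contractr counit_subdef (comul_subdef c) = c
}.
#[short(type="coalgType")]
HB.structure Definition Coalgebra (K : fieldType) :=
  {C of GRing.Lmodule K C & Lmodule_isCoalgebra K C}.

Section CoalgebraTheory.
Variables (K : fieldType) (C : coalgType K).
Definition comul : C -> C ⊗ C := comul_subdef.
Definition counit : C -> K^o := counit_subdef.
HB.instance Definition _ :=
  GRing.isLinear.Build K C _ _ comul (@linearP _ _ _ _ comul_subdef).
HB.instance Definition _ :=
  GRing.isLinear.Build K C _ _ counit (@linearP _ _ _ _ counit_subdef).
Lemma comulA c : tassoc (tmap comul idfun (comul c)) = tmap idfun comul (comul c).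
Proof. exact: comulA_subproof. Qed.
Lemma counitl c : contractl counit (comul c) = c.
Proof. exact: counitl_subproof. Qed.
Lemma counitr c : contractr counit (comul c) = c.
Proof. exact: counitr_subproof. Qed.
End CoalgebraTheory.
Arguments comul {K C}.
Arguments counit {K C}.

HB.mixin Record isBialgebra (K : fieldType) A
    of GRing.Algebra K A & Coalgebra K A := {
  comul_monoid_subproof : monoid_morphism (comul : A -> A ⊗ A);
  counit_monoid_subproof : monoid_morphism (counit : A -> K^o)
}.
#[short(type="bialgType")]
HB.structure Definition Bialgebra (K : fieldType) :=
  {A of GRing.Algebra K A & Coalgebra K A & isBialgebra K A}.

Section BialgebraTheory.
Variables (K : fieldType) (A : bialgType K).
Fact comul_monoid : monoid_morphism (comul : A -> A ⊗ A).
Proof. exact: comul_monoid_subproof. Qed.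
Fact counit_monoid : monoid_morphism (counit : A -> K^o).
Proof. exact: counit_monoid_subproof. Qed.
HB.instance Definition _ :=
  GRing.isMonoidMorphism.Build A _ (comul : A -> A ⊗ A) comul_monoid.
HB.instance Definition _ :=
  GRing.isMonoidMorphism.Build A _ (counit : A -> K^o) counit_monoid.
End BialgebraTheory.

Definition coalg_morphism (K : fieldType) (C D : coalgType K) (f : C -> D) :=
  [/\ linear f, forall c, comul (f c) = tmap f f (comul c)
    & forall c, counit (f c) = counit c].

Section AlgebraMaps.
Variables (K : fieldType) (A B C A' B' : algType K).

Lemma tens_monoid (U : algType K) (f : {linear A ⊗ B -> U}) :
  f (1 *t 1) = 1 ->
  (forall a b a' b', f ((a * a') *t (b * b')) = f (a *t b) * f (a' *t b')) ->
  monoid_morphism f.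
Proof.
move=> f1 fM; split=> // s t; move: s t.
elim/tens_ind=> [a b|s t Hs Ht|c s Hs] x; last 2 first.
- by rewrite mulrDl !linearD /= Hs Ht mulrDl.
- by rewrite -scalerAl !linearZ /= Hs scalerAl.
elim/tens_ind: x => [a' b'|s t Hs Ht|c s Hs]; last 2 first.
- by rewrite mulrDr !linearD /= Hs Ht mulrDr.
- by rewrite -scalerAr !linearZ /= Hs scalerAr.
by rewrite tens_mulE fM.
Qed.

Fact tmap_monoid (f : {lrmorphism A -> A'}) (g : {lrmorphism B -> B'}) :
  monoid_morphism (tmap f g).
Proof.
apply: tens_monoid => [|a b a' b'] /=; first by rewrite tmapE !rmorph1.
by rewrite !tmapE tens_mulE !rmorphM.
Qed.
HB.instance Definition _ (f : {lrmorphism A -> A'}) (g : {lrmorphism B -> B'}) :=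
  GRing.isMonoidMorphism.Build _ _ (tmap f g) (tmap_monoid f g).

Fact contractl_monoid (f : {lrmorphism A -> K^o}) :
  monoid_morphism (contractl f : (A ⊗ B) -> B).
Proof.
apply: tens_monoid => [|a b a' b'] /=; first by rewrite contractlE rmorph1 scale1r.
by rewrite !contractlE rmorphM /= -scalerAl -scalerAr scalerA.
Qed.
HB.instance Definition _ (f : {lrmorphism A -> K^o}) :=
  GRing.isMonoidMorphism.Build _ _ (contractl f : (A ⊗ B) -> B)
    (contractl_monoid f).
Fact contractr_monoid (g : {lrmorphism B -> K^o}) :
  monoid_morphism (contractr g : (A ⊗ B) -> A).
Proof.
apply: tens_monoid => [|a b a' b'] /=; first by rewrite contractrE rmorph1 scale1r.
by rewrite !contractrE rmorphM /= -scalerAl -scalerAr scalerA.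
Qed.
HB.instance Definition _ (g : {lrmorphism B -> K^o}) :=
  GRing.isMonoidMorphism.Build _ _ (contractr g : (A ⊗ B) -> A)
    (contractr_monoid g).

Fact tassoc_monoid : monoid_morphism (@tassoc K A B C).
Proof.
split; first by rewrite tassocE.
elim/tens_ind=> [s c|s t Hs Ht|a s Hs] x; last 2 first.
- by rewrite mulrDl !linearD /= Hs Ht mulrDl.
- by rewrite -scalerAl !linearZ /= Hs scalerAl.
elim/tens_ind: x => [t c'|x y Hx Hy|a x Hx]; last 2 first.
- by rewrite mulrDr !linearD /= Hx Hy mulrDr.
- by rewrite -scalerAr !linearZ /= Hx scalerAr.
elim/tens_ind: s => [a b|x y Hx Hy|k x Hx]; last 2 first.
- by rewrite tensDl mulrDl !linearD /= Hx Hy mulrDl.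
- by rewrite tensZl -scalerAl !linearZ /= Hx scalerAl.
elim/tens_ind: t => [a' b'|x y Hx Hy|k x Hx]; last 2 first.
- by rewrite tensDl mulrDr !linearD /= Hx Hy mulrDr.
- by rewrite tensZl -scalerAr !linearZ /= Hx scalerAr.
by rewrite !(tens_mulE, tassocE).
Qed.
HB.instance Definition _ :=
  GRing.isMonoidMorphism.Build _ _ (@tassoc K A B C) tassoc_monoid.
End AlgebraMaps.

(* The bialgebra structure of the tensor algebra of a coalgebra: the unique   *)
(* one whose restriction to the generators is the given coalgebra structure.  *)
Section TalgBialgebra.
Variables (K : fieldType) (W : coalgType K).
Local Notation T := (talg W).

Definition talg_comul : T -> (T ⊗ T) :=
  talg_lift (tmap (@tgen K W) (@tgen K W) \o comul).
Definition talg_counit : T -> K^o := talg_lift (counit : W -> K^o).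

HB.instance Definition _ := GRing.LRMorphism.on talg_comul.
HB.instance Definition _ := GRing.LRMorphism.on talg_counit.

Lemma talg_comul_gen w :
  talg_comul (tgen w) = tmap (@tgen K W) (@tgen K W) (comul w).
Proof. exact: talg_lift_gen. Qed.
Lemma talg_counit_gen w : talg_counit (tgen w) = counit w.
Proof. exact: talg_lift_gen. Qed.

Fact talg_comulA (t : T) : tassoc (tmap talg_comul idfun (talg_comul t)) =
  tmap idfun talg_comul (talg_comul t).
Proof.
pose f : {lrmorphism T -> T ⊗ (T ⊗ T)} :=
  @tassoc K T T T \o (tmap talg_comul idfun \o talg_comul).
pose g : {lrmorphism T -> T ⊗ (T ⊗ T)} := tmap idfun talg_comul \o talg_comul.
apply: (@talg_ext _ _ _ f g) => w /=.
rewrite !talg_comul_gen !tmap_comp /=.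
rewrite (@eq_tmap _ _ _ _ _ _ (tmap (@tgen K W) (@tgen K W) \o comul) _
  (@tgen K W \o idfun)) //; last exact: talg_comul_gen.
rewrite (@eq_tmap _ _ _ _ _ (idfun \o _) (@tgen K W \o idfun) _
  (tmap (@tgen K W) (@tgen K W) \o comul)) //; last exact: talg_comul_gen.
by rewrite -!tmap_comp tassoc_nat comulA.
Qed.
Fact talg_counitl (t : T) : contractl talg_counit (talg_comul t) = t.
Proof.
apply: (@talg_ext _ _ _ (contractl talg_counit \o talg_comul) idfun) => w /=.
rewrite talg_comul_gen contractl_tmap (@eq_contractl _ _ _ _ counit) ?counitl //.
exact: talg_counit_gen.
Qed.
Fact talg_counitr (t : T) : contractr talg_counit (talg_comul t) = t.
Proof.
apply: (@talg_ext _ _ _ (contractr talg_counit \o talg_comul) idfun) => w /=.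
rewrite talg_comul_gen contractr_tmap (@eq_contractr _ _ _ _ counit) ?counitr //.
exact: talg_counit_gen.
Qed.
HB.instance Definition _ := Lmodule_isCoalgebra.Build K T
  talg_comulA talg_counitl talg_counitr.
HB.instance Definition _ := isBialgebra.Build K T
  (talg_lift_monoid _) (talg_lift_monoid _).
Lemma comul_tgen w : comul (tgen w) = tmap (@tgen K W) (@tgen K W) (comul w).
Proof. exact: talg_comul_gen. Qed.
Lemma counit_tgen w : counit (tgen w) = counit w.
Proof. exact: talg_counit_gen. Qed.
End TalgBialgebra.

Section TensSums.
Variables (K : fieldType) (U V : lmodType K).
Lemma tens0l (v : V) : (0 : U) *t v = 0.
Proof. exact: (bilin0 (@bilin_tens K U V)). Qed.
Lemma tens0r (u : U) : u *t (0 : V) = 0.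
Proof. exact: (bilin0r (@bilin_tens K U V)). Qed.
Lemma tens_suml (I : Type) (r : seq I) (F : I -> U) (v : V) :
  (\sum_(i <- r) F i) *t v = \sum_(i <- r) F i *t v.
Proof.
exact: (big_morph (fun u => u *t v) (fun x y => tensDl x y v) (tens0l v)).
Qed.
Lemma tens_sumr (I : Type) (r : seq I) (F : I -> V) (u : U) :
  u *t (\sum_(i <- r) F i) = \sum_(i <- r) u *t F i.
Proof.
exact: (big_morph (fun v => u *t v) (fun x y => tensDr u x y) (tens0r u)).
Qed.
End TensSums.

Lemma tens_sum_mul (K : fieldType) (A B : algType K) (I J : finType)
    (a : I -> A) (b : I -> B) (a' : J -> A) (b' : J -> B) :
  (\sum_i a i *t b i) * (\sum_j a' j *t b' j) =
    \sum_i \sum_j (a i * a' j) *t (b i * b' j).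
Proof.
rewrite mulr_suml; apply: eq_bigr => i _; rewrite mulr_sumr.
by apply: eq_bigr => j _; rewrite tens_mulE.
Qed.

Lemma tmap_sum (K : fieldType) (U V U' V' : lmodType K) (f : {linear U -> U'})
    (g : {linear V -> V'}) (I : finType) (u : I -> U) (v : I -> V) :
  tmap f g (\sum_i u i *t v i) = \sum_i f (u i) *t g (v i).
Proof. by rewrite linear_sum; apply: eq_bigr => i _; apply: tmapE. Qed.

Section DualBasis.
Variables (K : fieldType) (V : vectType K).
Local Notation n := (\dim {:V}).

Definition dual : vectType K := 'Hom(V, K^o).
Definition ebasis (i : 'I_n) : V := (vbasis {:V})`_i.
Definition edual (i : 'I_n) : dual := linfun (coord (vbasis {:V}) i : V -> K^o).

Lemma ebasis_sum (v : V) : v = \sum_i (edual i : 'Hom(V, K^o)) v *: ebasis i.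
Proof.
rewrite {1}(coord_vbasis (memvf v)); apply: eq_bigr => i _.
by rewrite /edual lfunE.
Qed.
Lemma edual_sum (f : dual) : f = \sum_i (f : 'Hom(V, K^o)) (ebasis i) *: edual i.
Proof.
apply/lfunP => v; rewrite sum_lfunE {1}(ebasis_sum v) linear_sum.
by apply: eq_bigr => i _; rewrite linearZ scale_lfunE; apply: mulrC.
Qed.
End DualBasis.

(* The space V^* (x) V with the comultiplication dual to composition.         *)
Section CoEnd.
Variables (K : fieldType) (V : vectType K).
Local Notation app f v := ((f : 'Hom(V, K^o)) v).

Definition coend : Type := dual V ⊗ V.
HB.instance Definition _ := GRing.Lmodule.on coend.

Definition coend_comul : coend -> coend ⊗ coend :=
  tlift (fun f v => \sum_i (f *t ebasis i : coend) *t (edual i *t v : coend)).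
Definition coend_counit : coend -> K^o := tlift (fun f v => app f v).

Lemma bilin_coend_comul : bilin (fun (f : dual V) (v : V) =>
  \sum_i (f *t ebasis i : coend) *t (edual i *t v : coend)).
Proof.
split=> [v a f g|f a v w] /=; rewrite scaler_sumr -big_split /=.
  by apply: eq_bigr => i _; rewrite !(tensDl, tensZl).
by apply: eq_bigr => i _; rewrite !(tensDr, tensZr).
Qed.
Lemma bilin_coend_counit : bilin (fun (f : dual V) (v : V) => app f v).
Proof.
split=> [v a f g|f a v w] /=; last by rewrite linearP.
by rewrite add_lfunE scale_lfunE.
Qed.
HB.instance Definition _ := GRing.isLinear.Build K coend _ _ coend_comul
  (tlift_linear bilin_coend_comul).
HB.instance Definition _ := GRing.isLinear.Build K coend _ _ coend_counit
  (tlift_linear bilin_coend_counit).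

Lemma coend_comulE (f : dual V) (v : V) : coend_comul (f *t v) =
  \sum_i (f *t ebasis i : coend) *t (edual i *t v : coend).
Proof. exact: (tliftE bilin_coend_comul). Qed.
Lemma coend_counitE (f : dual V) (v : V) : coend_counit (f *t v) = app f v.
Proof. exact: (tliftE bilin_coend_counit). Qed.

Fact coend_comulA (c : coend) : tassoc (tmap coend_comul idfun (coend_comul c)) =
  tmap idfun coend_comul (coend_comul c).
Proof.
move: c; apply: tens_ext => [a x y|a x y|f v]; rewrite ?linearP //.
rewrite coend_comulE !linear_sum /=.
under eq_bigr => i _ do rewrite tmapE /= coend_comulE tens_suml linear_sum /=.
under [RHS]eq_bigr => i _ do rewrite tmapE /= coend_comulE tens_sumr.
rewrite exchange_big /=; apply: eq_bigr => i _; apply: eq_bigr => j _.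
by rewrite tassocE.
Qed.
Fact coend_counitl (c : coend) : contractl coend_counit (coend_comul c) = c.
Proof.
move: c; apply: tens_ext => [a x y|a x y|f v]; rewrite ?linearP //.
rewrite coend_comulE linear_sum /= [in RHS](edual_sum f) tens_suml.
by apply: eq_bigr => i _; rewrite contractlE /= coend_counitE tensZl.
Qed.
Fact coend_counitr (c : coend) : contractr coend_counit (coend_comul c) = c.
Proof.
move: c; apply: tens_ext => [a x y|a x y|f v]; rewrite ?linearP //.
rewrite coend_comulE linear_sum /= [in RHS](ebasis_sum v) tens_sumr.
by apply: eq_bigr => i _; rewrite contractrE /= coend_counitE tensZr.
Qed.
HB.instance Definition _ := Lmodule_isCoalgebra.Build K coend
  coend_comulA coend_counitl coend_counitr.
Lemma comul_coend (f : dual V) (v : V) : comul (f *t v : coend) =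
  \sum_i (f *t ebasis i : coend) *t (edual i *t v : coend).
Proof. exact: coend_comulE. Qed.
Lemma counit_coend (f : dual V) (v : V) : counit (f *t v : coend) = app f v.
Proof. exact: coend_counitE. Qed.
End CoEnd.

Section DualMap.
Variables (K : fieldType) (V : vectType K).
Local Notation app f v := ((f : 'Hom(V, K^o)) v).

Definition tpair (t : dual V ⊗ dual V) (x : V ⊗ V) : K^o :=
  tlift (fun f g => tlift (fun v w => app f v * app g w : K^o) x) t.

(* The dual map of R for the pairing above, see tdualP.                       *)
Definition tdual (R : V ⊗ V -> V ⊗ V) (t : dual V ⊗ dual V) : dual V ⊗ dual V :=
  \sum_i \sum_j (tpair t (R (ebasis i *t ebasis j)) : K) *: (edual i *t edual j).

Lemma bilin_tpair2 (f g : dual V) : bilin (fun v w => app f v * app g w : K^o).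
Proof.
by split=> [w a u v|v a u w] /=;
  rewrite linearP !(mulrDl, mulrDr, =^~ scalerAl, =^~ scalerAr).
Qed.
Lemma bilin_tpair1 (x : V ⊗ V) : bilin (fun f g : dual V =>
  tlift (fun v w => app f v * app g w : K^o) x).
Proof.
split=> [g|f].
  apply: (tlift_bilin _ _).2 => [f|v w a f f']; first exact: bilin_tpair2.
  by rewrite add_lfunE scale_lfunE mulrDl -scalerAl.
apply: (tlift_bilin _ _).2 => [g|v w a g g']; first exact: bilin_tpair2.
by rewrite add_lfunE scale_lfunE mulrDr -scalerAr.
Qed.
Lemma bilin_tpair : bilin tpair.
Proof.
apply: tlift_bilin => [x|f g]; first exact: bilin_tpair1.
exact/tlift_linear/bilin_tpair2.
Qed.
Lemma tpairE (f g : dual V) (v w : V) :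
  tpair (f *t g) (v *t w) = app f v * app g w.
Proof.
by rewrite /tpair (tliftE (bilin_tpair1 _)) (tliftE (bilin_tpair2 _ _)).
Qed.
HB.instance Definition _ t :=
  GRing.isLinear.Build K _ _ _ (tpair t) (bilin_tpair.2 t).

Lemma tpair_basis (x : V ⊗ V) :
  x = \sum_i \sum_j (tpair (edual i *t edual j) x : K) *: (ebasis i *t ebasis j).
Proof.
elim/tens_ind: x => [v w|x y Hx Hy|a x Hx]; last 2 first.
- rewrite {1}Hx {1}Hy -big_split; apply: eq_bigr => i _.
  rewrite -big_split; apply: eq_bigr => j _.
  by rewrite linearD; apply/esym/scalerDl.
- rewrite {1}Hx scaler_sumr; apply: eq_bigr => i _.
  rewrite scaler_sumr; apply: eq_bigr => j _.
  by rewrite scalerA; congr (_ *: _); rewrite linearZ.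
rewrite {1}(ebasis_sum v) {1}(ebasis_sum w) tens_suml; apply: eq_bigr => i _.
rewrite tens_sumr; apply: eq_bigr => j _.
by rewrite tensZl tensZr scalerA tpairE.
Qed.

Lemma tdual_linear R : linear (tdual R).
Proof.
move=> a s t; rewrite /tdual scaler_sumr -big_split; apply: eq_bigr => i _.
rewrite scaler_sumr -big_split; apply: eq_bigr => j _ /=.
by rewrite (bilin_tpair.1 _ a) scalerA; apply: scalerDl.
Qed.
HB.instance Definition _ R :=
  GRing.isLinear.Build K _ _ _ (tdual R) (tdual_linear R).

Lemma tdualP (R : {linear V ⊗ V -> V ⊗ V}) t x :
  tpair (tdual R t) x = tpair t (R x).
Proof.
have suml (I : finType) (F : I -> dual V ⊗ dual V) :
    tpair (\sum_i F i) x = \sum_i tpair (F i) x.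
  exact: (big_morph (fun u => tpair u x)
    (fun y z => bilinD2l bilin_tpair y z x) (bilin0 bilin_tpair x)).
rewrite [in RHS](tpair_basis x) !linear_sum /= suml; apply: eq_bigr => i _.
rewrite !linear_sum /= suml; apply: eq_bigr => j _.
by rewrite !linearZ (bilinZ2l bilin_tpair); apply: mulrC.
Qed.
End DualMap.

Inductive ideal_gen (K : fieldType) (A : algType K) (S : A -> Prop) : A -> Prop :=
  | ig_mem s : S s -> ideal_gen S s
  | ig_0 : ideal_gen S 0
  | ig_add s t : ideal_gen S s -> ideal_gen S t -> ideal_gen S (s + t)
  | ig_mull a s : ideal_gen S s -> ideal_gen S (a * s)
  | ig_mulr a s : ideal_gen S s -> ideal_gen S (s * a).

Lemma ideal_gen_ker (K : fieldType) (A B : algType K) (S : A -> Prop)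
    (f : {lrmorphism A -> B}) :
  (forall s, S s -> f s = 0) -> forall s, ideal_gen S s -> f s = 0.
Proof.
move=> fS s; elim=> {s} [s /fS//||s t _ Hs _ Ht|a s _ Hs|a s _ Hs].
- by rewrite rmorph0.
- by rewrite rmorphD /= Hs Ht addr0.
- by rewrite rmorphM /= Hs mulr0.
- by rewrite rmorphM /= Hs mul0r.
Qed.

(* Proper, as the algebras of the library are nonzero.                        *)
Record proper_ideal (K : fieldType) (A : algType K) := ProperIdeal {
  ideal_pred :> A -> Prop;
  ideal0 : ideal_pred 0;
  idealD : forall s t, ideal_pred s -> ideal_pred t -> ideal_pred (s + t);
  idealMl : forall a s, ideal_pred s -> ideal_pred (a * s);
  idealMr : forall a s, ideal_pred s -> ideal_pred (s * a);
  ideal_proper : ~ ideal_pred 1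
}.

Section QuotientAlgebra.
Variables (K : fieldType) (A : algType K) (J : proper_ideal A).

Definition aquot_rel (a b : A) := `[< J (a - b) >].

Lemma idealZ c a : J a -> J (c *: a).
Proof. by move=> Ja; rewrite -mulr_algl; apply: idealMl. Qed.
Lemma idealN a : J a -> J (- a).
Proof. by rewrite -scaleN1r; apply: idealZ. Qed.

Fact aquot_rel_refl : reflexive aquot_rel.
Proof. by move=> a; apply/asboolP; rewrite subrr; apply: ideal0. Qed.
Fact aquot_rel_sym : symmetric aquot_rel.
Proof.
by move=> a b; apply/asboolP/asboolP => /idealN; rewrite opprB.
Qed.
Fact aquot_rel_trans : transitive aquot_rel.
Proof.
move=> b a c /asboolP ab /asboolP bc; apply/asboolP.
by have := idealD ab bc; rewrite addrA subrK.
Qed.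
Canonical aquot_equiv :=
  EquivRel aquot_rel aquot_rel_refl aquot_rel_sym aquot_rel_trans.

Definition aquot : Type := {eq_quot aquot_equiv}.
HB.instance Definition _ := Choice.on aquot.
HB.instance Definition _ := Quotient.on aquot.

Definition aproj (a : A) : aquot := \pi_aquot a.

Lemma aprojP a b : aproj a = aproj b <-> J (a - b).
Proof.
split=> [/(@eqquotP _ aquot_equiv aquot)/asboolP //|Jab].
by apply/(@eqquotP _ aquot_equiv aquot)/asboolP.
Qed.
Lemma aproj_repr a : J (repr (aproj a) - a).
Proof. by apply/aprojP; rewrite /aproj reprK. Qed.
Lemma aprojW (P : aquot -> Prop) : (forall a, P (aproj a)) -> forall t, P t.
Proof. by move=> PA; elim/quotW; apply: PA. Qed.

Definition aquot_add (s t : aquot) : aquot := aproj (repr s + repr t).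
Definition aquot_opp (s : aquot) : aquot := aproj (- repr s).
Definition aquot_mul (s t : aquot) : aquot := aproj (repr s * repr t).
Definition aquot_scale (c : K) (s : aquot) : aquot := aproj (c *: repr s).

Lemma aquot_addE a b : aquot_add (aproj a) (aproj b) = aproj (a + b).
Proof.
apply/aprojP; rewrite opprD addrACA.
by apply: idealD; apply: aproj_repr.
Qed.
Lemma aquot_oppE a : aquot_opp (aproj a) = aproj (- a).
Proof. by apply/aprojP; rewrite -opprD; apply/idealN/aproj_repr. Qed.
Lemma aquot_scaleE c a : aquot_scale c (aproj a) = aproj (c *: a).
Proof. by apply/aprojP; rewrite -scalerBr; apply/idealZ/aproj_repr. Qed.
Lemma aquot_mulE a b : aquot_mul (aproj a) (aproj b) = aproj (a * b).
Proof.
apply/aprojP; set x := repr _; set y := repr _.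
have -> : x * y - a * b = (x - a) * y + a * (y - b).
  by rewrite mulrBl mulrBr addrA subrK.
by apply: idealD; [apply: idealMr|apply: idealMl]; apply: aproj_repr.
Qed.

Fact aquot_addA : associative aquot_add.
Proof.
elim/aprojW=> x; elim/aprojW=> y; elim/aprojW=> z.
by rewrite (aquot_addE y z) (aquot_addE x y) !aquot_addE addrA.
Qed.
Fact aquot_addC : commutative aquot_add.
Proof. by elim/aprojW=> x; elim/aprojW=> y; rewrite !aquot_addE addrC. Qed.
Fact aquot_add0 : left_id (aproj 0) aquot_add.
Proof. by elim/aprojW=> x; rewrite aquot_addE add0r. Qed.
Fact aquot_addN : left_inverse (aproj 0) aquot_opp aquot_add.
Proof. by elim/aprojW=> x; rewrite (aquot_oppE x) aquot_addE addNr. Qed.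
HB.instance Definition _ :=
  GRing.isZmodule.Build aquot aquot_addA aquot_addC aquot_add0 aquot_addN.

Fact aquot_scaleA a b t : aquot_scale a (aquot_scale b t) = aquot_scale (a * b) t.
Proof.
by elim/aprojW: t => x; rewrite (aquot_scaleE b x) !aquot_scaleE scalerA.
Qed.
Fact aquot_scale1 : left_id 1 aquot_scale.
Proof. by elim/aprojW=> x; rewrite aquot_scaleE scale1r. Qed.
Fact aquot_scaleDr : right_distributive aquot_scale +%R.
Proof.
move=> a; elim/aprojW=> x; elim/aprojW=> y.
by rewrite [_ + _]aquot_addE !aquot_scaleE [RHS]aquot_addE scalerDr.
Qed.
Fact aquot_scaleDl t : {morph aquot_scale^~ t : a b / a + b}.
Proof.
move=> a b; elim/aprojW: t => x.
by rewrite !aquot_scaleE [RHS]aquot_addE scalerDl.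
Qed.
HB.instance Definition _ := GRing.Zmodule_isLmodule.Build K aquot
  aquot_scaleA aquot_scale1 aquot_scaleDr aquot_scaleDl.

Fact aquot_mulA : associative aquot_mul.
Proof.
elim/aprojW=> x; elim/aprojW=> y; elim/aprojW=> z.
by rewrite (aquot_mulE y z) (aquot_mulE x y) !aquot_mulE mulrA.
Qed.
Fact aquot_mul1l : left_id (aproj 1) aquot_mul.
Proof. by elim/aprojW=> x; rewrite aquot_mulE mul1r. Qed.
Fact aquot_mul1r : right_id (aproj 1) aquot_mul.
Proof. by elim/aprojW=> x; rewrite aquot_mulE mulr1. Qed.
Fact aquot_mulDl : left_distributive aquot_mul +%R.
Proof.
elim/aprojW=> x; elim/aprojW=> y; elim/aprojW=> z.
by rewrite [X in aquot_mul X _]aquot_addE !aquot_mulE [RHS]aquot_addE mulrDl.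
Qed.
Fact aquot_mulDr : right_distributive aquot_mul +%R.
Proof.
elim/aprojW=> x; elim/aprojW=> y; elim/aprojW=> z.
by rewrite [X in aquot_mul _ X]aquot_addE !aquot_mulE [RHS]aquot_addE mulrDr.
Qed.
Fact aquot_one_neq0 : aproj 1 != aproj 0.
Proof. by apply/eqP => /aprojP; rewrite subr0; apply: ideal_proper. Qed.
HB.instance Definition _ := GRing.Zmodule_isNzRing.Build aquot
  aquot_mulA aquot_mul1l aquot_mul1r aquot_mulDl aquot_mulDr aquot_one_neq0.

Fact aquot_scaleAl (a : K) (s t : aquot) : a *: (s * t) = (a *: s) * t.
Proof.
elim/aprojW: s => x; elim/aprojW: t => y.
rewrite [_ * _]aquot_mulE [X in _ = X * _]aquot_scaleE [LHS]aquot_scaleE.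
by rewrite [RHS]aquot_mulE scalerAl.
Qed.
HB.instance Definition _ := GRing.Lmodule_isLalgebra.Build K aquot aquot_scaleAl.
Fact aquot_scaleAr (a : K) (s t : aquot) : a *: (s * t) = s * (a *: t).
Proof.
elim/aprojW: s => x; elim/aprojW: t => y.
rewrite [_ * _]aquot_mulE [X in _ = _ * X]aquot_scaleE [LHS]aquot_scaleE.
by rewrite [RHS]aquot_mulE scalerAr.
Qed.
HB.instance Definition _ := GRing.Lalgebra_isAlgebra.Build K aquot aquot_scaleAr.

Fact aproj_linear : linear aproj.
Proof.
by move=> a x y; rewrite [X in _ = X + _]aquot_scaleE [RHS]aquot_addE.
Qed.
Fact aproj_monoid : monoid_morphism aproj.
Proof. by split=> // x y; rewrite [RHS]aquot_mulE. Qed.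
HB.instance Definition _ := GRing.isLinear.Build K A aquot _ aproj aproj_linear.
HB.instance Definition _ := GRing.isMonoidMorphism.Build A aquot aproj aproj_monoid.

(* The factorization through A/J of a map vanishing on J.                     *)
Definition aquot_lift (T : Type) (f : A -> T) (t : aquot) : T := f (repr t).

Section AquotLift.
Variables (B : algType K) (f : {lrmorphism A -> B}).
Hypothesis fJ : forall a, J a -> f a = 0.

Lemma aquot_liftE a : aquot_lift f (aproj a) = f a.
Proof.
by apply/eqP; rewrite -subr_eq0 -rmorphB /=; apply/eqP/fJ/aproj_repr.
Qed.
Lemma aquot_lift_linear : linear (aquot_lift f).
Proof.
move=> a; elim/aprojW=> x; elim/aprojW=> y.
by rewrite -linearP !aquot_liftE linearP.
Qed.
Lemma aquot_lift_monoid : monoid_morphism (aquot_lift f).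
Proof.
split; first by rewrite -(rmorph1 aproj) aquot_liftE rmorph1.
elim/aprojW=> x; elim/aprojW=> y.
by rewrite -rmorphM !aquot_liftE rmorphM.
Qed.
End AquotLift.
End QuotientAlgebra.

Record biideal (K : fieldType) (A : bialgType K) := Biideal {
  biideal_ideal :> proper_ideal A;
  biideal_comul : forall a, biideal_ideal a ->
    tmap (aproj biideal_ideal) (aproj biideal_ideal) (comul a) = 0;
  biideal_counit : forall a, biideal_ideal a -> counit a = 0
}.

Section QuotientBialgebra.
Variables (K : fieldType) (A : bialgType K) (J : biideal A).

Definition bquot : Type := aquot J.
HB.instance Definition _ := GRing.Algebra.on bquot.
Definition bproj : A -> bquot := aproj J.
HB.instance Definition _ := GRing.LRMorphism.on bproj.

Definition bquot_pre : A -> bquot ⊗ bquot := tmap bproj bproj \o comul.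
HB.instance Definition _ := GRing.LRMorphism.on bquot_pre.

Definition bquot_comul : bquot -> bquot ⊗ bquot := aquot_lift bquot_pre.
Definition bquot_counit : bquot -> K^o := aquot_lift (counit : A -> K^o).

Let DJ a : J a -> bquot_pre a = 0.
Proof. exact: biideal_comul. Qed.
Let eJ a : J a -> counit a = 0.
Proof. exact: biideal_counit. Qed.

HB.instance Definition _ := GRing.isLinear.Build K bquot _ _ bquot_comul
  (aquot_lift_linear DJ).
HB.instance Definition _ := GRing.isMonoidMorphism.Build bquot _ bquot_comul
  (aquot_lift_monoid DJ).
HB.instance Definition _ := GRing.isLinear.Build K bquot _ _ bquot_counit
  (aquot_lift_linear eJ).
HB.instance Definition _ := GRing.isMonoidMorphism.Build bquot _ bquot_counit
  (aquot_lift_monoid eJ).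

Lemma bquot_comulE a : bquot_comul (bproj a) = tmap bproj bproj (comul a).
Proof. exact: (aquot_liftE DJ). Qed.
Lemma bquot_counitE a : bquot_counit (bproj a) = counit a.
Proof. exact: (aquot_liftE eJ). Qed.

Fact bquot_comulA (x : bquot) : tassoc (tmap bquot_comul idfun (bquot_comul x)) =
  tmap idfun bquot_comul (bquot_comul x).
Proof.
elim/(@aprojW _ _ J): x => a.
rewrite !bquot_comulE !tmap_comp.
rewrite (@eq_tmap _ _ _ _ _ _ (tmap bproj bproj \o comul) _
  (bproj \o idfun)) //; last exact: bquot_comulE.
rewrite (@eq_tmap _ _ _ _ _ (idfun \o _) (bproj \o idfun) _
  (tmap bproj bproj \o comul)) //; last exact: bquot_comulE.
by rewrite -!tmap_comp tassoc_nat comulA.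
Qed.
Fact bquot_counitl (x : bquot) : contractl bquot_counit (bquot_comul x) = x.
Proof.
elim/(@aprojW _ _ J): x => a.
rewrite bquot_comulE contractl_tmap (@eq_contractl _ _ _ _ counit) ?counitl //.
exact: bquot_counitE.
Qed.
Fact bquot_counitr (x : bquot) : contractr bquot_counit (bquot_comul x) = x.
Proof.
elim/(@aprojW _ _ J): x => a.
rewrite bquot_comulE contractr_tmap (@eq_contractr _ _ _ _ counit) ?counitr //.
exact: bquot_counitE.
Qed.
HB.instance Definition _ := Lmodule_isCoalgebra.Build K bquot
  bquot_comulA bquot_counitl bquot_counitr.
HB.instance Definition _ := isBialgebra.Build K bquot
  (aquot_lift_monoid DJ) (aquot_lift_monoid eJ).
Lemma comul_bproj a : comul (bproj a) = tmap bproj bproj (comul a).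
Proof. exact: bquot_comulE. Qed.
Lemma counit_bproj a : counit (bproj a) = counit a.
Proof. exact: bquot_counitE. Qed.
End QuotientBialgebra.

Section FRT.
Variables (K : fieldType) (V : vectType K) (R : {linear V ⊗ V -> V ⊗ V}).
Local Notation W := (coend V).
Local Notation T := (talg W).

Definition frt_alpha : W ⊗ W -> W ⊗ W :=
  @tmid K (dual V) (dual V) V V \o tmap (tdual R) idfun \o
    @tmid K (dual V) V (dual V) V.
Definition frt_beta : W ⊗ W -> W ⊗ W :=
  @tmid K (dual V) (dual V) V V \o tmap idfun R \o
    @tmid K (dual V) V (dual V) V.

(* The inclusion of W (x) W as the degree two part of the tensor algebra.     *)
Definition tdeg2 (U : lmodType K) : U ⊗ U -> talg U :=
  tlift (fun a b => tgen a * tgen b).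

Definition frt_rel (t : T) := exists x, t = tdeg2 (frt_alpha x - frt_beta x).

Lemma bilin_tdeg2 (U : lmodType K) :
  bilin (fun a b : U => tgen a * tgen b).
Proof.
split=> [b c x y|a c x y] /=; rewrite linearP.
  by rewrite mulrDl -scalerAl.
by rewrite mulrDr -scalerAr.
Qed.
HB.instance Definition _ U :=
  GRing.isLinear.Build K _ _ _ (@tdeg2 U) (tlift_linear (@bilin_tdeg2 U)).
Lemma tdeg2E (U : lmodType K) (a b : U) : tdeg2 (a *t b) = tgen a * tgen b.
Proof. exact: (tliftE (@bilin_tdeg2 U)). Qed.

Definition frt_N (t : dual V ⊗ dual V) (s : V ⊗ V) : T :=
  tdeg2 (tmid (t *t s) : W ⊗ W).

Lemma bilin_frt_N : bilin frt_N.
Proof.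
by split=> [s a x y|t a x y]; rewrite /frt_N
  ?(tensDl, tensZl, tensDr, tensZr) linearP /= linearP.
Qed.

Lemma frt_N_tens (f g : dual V) (v w : V) :
  frt_N (f *t g) (v *t w) = tgen (f *t v : W) * tgen (g *t w : W).
Proof. by rewrite /frt_N tmidE tdeg2E. Qed.

Lemma bilin_ext (A B C D X : lmodType K) (b b' : A ⊗ B -> C ⊗ D -> X) :
  bilin b -> bilin b' ->
  (forall u v x y, b (u *t v) (x *t y) = b' (u *t v) (x *t y)) ->
  forall s t, b s t = b' s t.
Proof.
move=> bb bb' e s t; move: s; apply: tens_ext => [||u v].
- exact: bb.1.
- exact: bb'.1.
by move: t; apply: tens_ext => [||x y]; [exact: bb.2|exact: bb'.2|exact: e].
Qed.

Lemma frt_rel_ker (X : lmodType K) (h : {linear T -> X}) :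
  (forall t s, h (frt_N (tdual R t) s) = h (frt_N t (R s))) ->
  forall x, frt_rel x -> h x = 0.
Proof.
move=> hR _ [x ->]; rewrite !linearB /=; apply/eqP; rewrite subr_eq0; apply/eqP.
have la : linear (fun x => h (tdeg2 (frt_alpha x))).
  by move=> a y z; rewrite /frt_alpha /= !linearP.
have lb : linear (fun x => h (tdeg2 (frt_beta x))).
  by move=> a y z; rewrite /frt_beta /= !linearP.
move: x; apply: tens_ext => // c d.
apply: (@bilin_ext _ _ _ _ _ (fun c d : W => h (tdeg2 (frt_alpha (c *t d))))
  (fun c d : W => h (tdeg2 (frt_beta (c *t d))))); last first.
- move=> f v g w; have := hR (f *t g) (v *t w).
  by rewrite /frt_N /frt_alpha /frt_beta /= !tmidE !tmapE.
- exact: bilin_comp lb (@bilin_tens _ _ _).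
- exact: bilin_comp la (@bilin_tens _ _ _).
Qed.

Lemma counit_frt_N t s : (counit : T -> K^o) (frt_N t s) = tpair t s.
Proof.
move: t s; apply: bilin_ext; [|exact: bilin_tpair|].
  exact: bilin_comp (@linearP _ _ _ _ (counit : {linear T -> K^o})) bilin_frt_N.
move=> f g v w; rewrite frt_N_tens rmorphM /= tpairE.
by rewrite !counit_tgen !counit_coend.
Qed.

Lemma comul_frt_N t s : (comul : T -> (T ⊗ T)) (frt_N t s) =
  \sum_i \sum_j frt_N t (ebasis i *t ebasis j) *t frt_N (edual i *t edual j) s.
Proof.
have [lN rN] := bilin_frt_N.
move: t s; apply: bilin_ext.
- exact: bilin_comp (@linearP _ _ _ _ (comul : {linear T -> T ⊗ T})) bilin_frt_N.
- split=> [s a x y|t a x y]; rewrite scaler_sumr -big_split; apply: eq_bigr => i _;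
    rewrite scaler_sumr -big_split; apply: eq_bigr => j _ /=.
    by rewrite (lN _ a) tensDl tensZl.
  by rewrite (rN _ a) tensDr tensZr.
move=> f g v w; rewrite frt_N_tens rmorphM /= !comul_tgen.
rewrite !comul_coend !tmap_sum tens_sum_mul.
by apply: eq_bigr => i _; apply: eq_bigr => j _; rewrite !frt_N_tens.
Qed.

Lemma counit_frt_ideal t : ideal_gen frt_rel t -> counit t = 0.
Proof.
apply: ideal_gen_ker => {}t; apply: frt_rel_ker => {}t s /=.
by rewrite !counit_frt_N tdualP.
Qed.

Fact frt_proper : ~ ideal_gen frt_rel 1.
Proof.
by move=> /counit_frt_ideal; rewrite rmorph1 => /eqP; rewrite oner_eq0.
Qed.

Definition frt_ideal : proper_ideal T := ProperIdeal (@ig_0 _ _ frt_rel)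
  (@ig_add _ _ frt_rel) (@ig_mull _ _ frt_rel) (@ig_mulr _ _ frt_rel) frt_proper.

Local Notation q := (aproj frt_ideal).

Lemma frt_aproj_N t s : q (frt_N (tdual R t) s) = q (frt_N t (R s)).
Proof.
apply/(aprojP frt_ideal)/ig_mem; exists (tmid (t *t s)).
rewrite linearB /= /frt_alpha /frt_beta /=.
have tmidK (A B C D : lmodType K) : cancel (@tmid K A B C D) (@tmid K A C B D).
  apply: tens_ext => [a x y|a x y|x y]; rewrite ?linearP //.
  move: x y; apply: bilin_ext.
  - by split=> [s' a y z|t' a y z] /=;
      rewrite ?(tensDl, tensZl, tensDr, tensZr) !linearP.
  - exact: bilin_tens.
  by move=> *; rewrite !tmidE.
by rewrite tmidK !tmapE.
Qed.

Lemma comul_frt_ideal t : ideal_gen frt_rel t -> tmap q q (comul t) = 0.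
Proof.
apply: (ideal_gen_ker (f := tmap q q \o comul)) => {}t; apply: frt_rel_ker => {}t s /=.
rewrite !comul_frt_N.
have qN := frt_aproj_N; have [lN rN] := bilin_frt_N.
have sumNl (I : finType) (F : I -> V ⊗ V) u :
    frt_N u (\sum_i F i) = \sum_i frt_N u (F i).
  exact: (big_morph (frt_N u) (fun y z => bilinD2r bilin_frt_N u y z)
    (bilin0r bilin_frt_N u)).
have sumNr (I : finType) (F : I -> dual V ⊗ dual V) u :
    frt_N (\sum_i F i) u = \sum_i frt_N (F i) u.
  exact: (big_morph (frt_N^~ u) (fun y z => bilinD2l bilin_frt_N y z u)
    (bilin0 bilin_frt_N u)).
have exch4 (I J : finType) (X : lmodType K) (F : I -> J -> I -> J -> X) :
    \sum_i \sum_j \sum_k \sum_l F i j k l = \sum_k \sum_l \sum_i \sum_j F i j k l.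
  transitivity (\sum_i \sum_k \sum_j \sum_l F i j k l).
    by apply: eq_bigr => i _; rewrite exchange_big.
  rewrite exchange_big; apply: eq_bigr => k _ /=.
  transitivity (\sum_i \sum_l \sum_j F i j k l).
    by apply: eq_bigr => i _; rewrite exchange_big.
  by rewrite exchange_big.
pose F i j k l := q (frt_N t (ebasis k *t ebasis l)) *t
  q (frt_N ((tpair (edual k *t edual l) (R (ebasis i *t ebasis j)) : K)
    *: (edual i *t edual j)) s).
transitivity (\sum_i \sum_j \sum_k \sum_l F i j k l).
  rewrite !linear_sum; apply: eq_bigr => i _.
  rewrite !linear_sum; apply: eq_bigr => j _ /=.
  rewrite tmapE /= qN (tpair_basis (R _)) sumNl linear_sum tens_suml.
  apply: eq_bigr => k _; rewrite sumNl linear_sum tens_suml.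
  apply: eq_bigr => l _; rewrite /F.
  rewrite (bilinZ2r bilin_frt_N) (bilinZ2l bilin_frt_N) !linearZ /=.
  by rewrite tensZl tensZr.
rewrite exch4 !linear_sum; apply: eq_bigr => k _.
rewrite !linear_sum; apply: eq_bigr => l _ /=.
rewrite tmapE /= -qN /tdual sumNr linear_sum tens_sumr.
apply: eq_bigr => i _; rewrite sumNr linear_sum tens_sumr.
by apply: eq_bigr.
Qed.

Definition frt_biideal : biideal T :=
  @Biideal _ _ frt_ideal comul_frt_ideal counit_frt_ideal.

Definition frt : bialgType K := bquot frt_biideal.
End FRT.

(* A with the order of multiplication reversed.                               *)
Section OppositeBialgebra.
Variables (K : fieldType) (A : bialgType K).

Definition opbialg : Type := A.
HB.instance Definition _ := Coalgebra.on opbialg.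

Definition op_mul (x y : opbialg) : opbialg := (y : A) * (x : A).
Fact op_mulA : associative op_mul.
Proof. by move=> x y z; rewrite /op_mul mulrA. Qed.
Fact op_mul1l : left_id (1 : A) op_mul.
Proof. by move=> x; rewrite /op_mul mulr1. Qed.
Fact op_mul1r : right_id (1 : A) op_mul.
Proof. by move=> x; rewrite /op_mul mul1r. Qed.
Fact op_mulDl : left_distributive op_mul +%R.
Proof. by move=> x y z; rewrite /op_mul mulrDr. Qed.
Fact op_mulDr : right_distributive op_mul +%R.
Proof. by move=> x y z; rewrite /op_mul mulrDl. Qed.
HB.instance Definition _ := GRing.Zmodule_isNzRing.Build opbialg
  op_mulA op_mul1l op_mul1r op_mulDl op_mulDr (oner_neq0 A).
Fact op_scaleAl (a : K) (x y : opbialg) : a *: op_mul x y = op_mul (a *: x) y.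
Proof. exact: (@scalerAr K A a y x). Qed.
HB.instance Definition _ := GRing.Lmodule_isLalgebra.Build K opbialg op_scaleAl.
Fact op_scaleAr (a : K) (x y : opbialg) : a *: op_mul x y = op_mul x (a *: y).
Proof. exact: (@scalerAl K A a y x). Qed.
HB.instance Definition _ := GRing.Lalgebra_isAlgebra.Build K opbialg op_scaleAr.

Lemma op_tmulE (s t : opbialg ⊗ opbialg) :
  s * t = (t : A ⊗ A) * (s : A ⊗ A) :> A ⊗ A.
Proof.
pose b (s t : A ⊗ A) : A ⊗ A := (s : opbialg ⊗ opbialg) * (t : opbialg ⊗ opbialg).
pose b' (s t : A ⊗ A) : A ⊗ A := t * s.
have bb : bilin b by exact: (@bilin_tmul K opbialg opbialg).
have bb' : bilin b' by exact: (bilinC (@bilin_tmul K A A)).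
apply: (bilin_ext bb bb') => u v x y; rewrite /b' tens_mulE.
exact: (@tens_mulE K opbialg opbialg).
Qed.

Lemma op_mulE (x y : opbialg) : x * y = (y : A) * (x : A) :> A.
Proof. by []. Qed.

Fact op_comul_monoid : monoid_morphism (comul : opbialg -> opbialg ⊗ opbialg).
Proof.
split=> [|x y]; first exact: (comul_monoid A).1.
by rewrite op_tmulE; apply: (comul_monoid A).2.
Qed.
Fact op_counit_monoid : monoid_morphism (counit : opbialg -> K^o).
Proof.
split=> [|x y]; first exact: (counit_monoid A).1.
by rewrite [RHS]mulrC; apply: (counit_monoid A).2.
Qed.
HB.instance Definition _ :=
  isBialgebra.Build K opbialg op_comul_monoid op_counit_monoid.
End OppositeBialgebra.

(* t lies in the image of S (x) S.                                            *)
Definition tens_span (K : fieldType) (U : lmodType K) (S : {pred U})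
    (t : U ⊗ U) : Prop :=
  exists l : seq (U * U), all (fun x => (x.1 \in S) && (x.2 \in S)) l /\
    t = \sum_(x <- l) x.1 *t x.2.

Record subbialg (K : fieldType) (A : bialgType K) := SubBialg {
  subbialg_pred :> {pred A};
  subbialg_algP : subalg_closed subbialg_pred;
  subbialg_comulP : {in subbialg_pred, forall a, tens_span subbialg_pred (comul a)}
}.

Section SubBialgebra.
Variables (K : fieldType) (A : bialgType K) (S : subbialg A).

Record subb : Type := SubB { subb_val : A; subb_valP : subb_val \in S }.
HB.instance Definition _ := [isSub for subb_val].
HB.instance Definition _ := [Choice of subb by <:].
HB.instance Definition _ := GRing.SubChoice_isSubAlgebra.Build K A _ subb
  (GRing.subalg_closed_semi (subbialg_algP S)).

Lemma subb_val_linear : linear subb_val.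
Proof. by move=> a x y; rewrite -[subb_val]/val !linearP. Qed.
Lemma subb_val_monoid : monoid_morphism subb_val.
Proof. by split=> [|x y]; rewrite -[subb_val]/val ?rmorph1 ?rmorphM. Qed.
HB.instance Definition _ := GRing.isLinear.Build K subb A _ subb_val subb_val_linear.
HB.instance Definition _ :=
  GRing.isMonoidMorphism.Build subb A subb_val subb_val_monoid.

Lemma subb_val_inj : injective subb_val.
Proof. exact: val_inj. Qed.

(* Any linear retraction of the inclusion gives the same comultiplication,    *)
(* see subb_comulE.                                                           *)
Definition subb_retr : {linear A -> subb} := projT1 (cid (retraction subb_val_inj)).
Lemma subb_valK : cancel subb_val subb_retr.
Proof. by rewrite /subb_retr; case: cid. Qed.

Definition subb_comul : subb -> subb ⊗ subb :=
  tmap subb_retr subb_retr \o (comul \o subb_val).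
Definition subb_counit : subb -> K^o := counit \o subb_val.
HB.instance Definition _ := GRing.Linear.on subb_comul.
HB.instance Definition _ := GRing.LRMorphism.on subb_counit.

Lemma subb_comulE s : tmap subb_val subb_val (subb_comul s) = comul (subb_val s).
Proof.
rewrite /subb_comul /= tmap_comp.
have [l [/allP lS ->]] := subbialg_comulP (subb_valP s).
rewrite linear_sum /= big_seq [RHS]big_seq; apply: eq_bigr => x /lS /andP[x1 x2].
rewrite tmapE /=.
have fixS a : a \in S -> subb_val (subb_retr a) = a.
  by move=> aS; rewrite -[a in LHS]/(subb_val (SubB aS)) subb_valK.
by rewrite !fixS.
Qed.

Lemma tmap_subb_inj : injective (tmap subb_val subb_val).
Proof.
apply: (@can_inj _ _ _ (tmap subb_retr subb_retr)) => t.
rewrite tmap_comp (@eq_tmap _ _ _ _ _ _ idfun _ idfun); try exact: subb_valK.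
by move: t; apply: tens_ext => [a x y|a x y|u v]; rewrite ?linearP // tmapE.
Qed.
Lemma tmap3_subb_inj : injective (tmap subb_val (tmap subb_val subb_val)).
Proof.
apply: (@can_inj _ _ _ (tmap subb_retr (tmap subb_retr subb_retr))) => t.
rewrite tmap_comp (@eq_tmap _ _ _ _ _ _ idfun _ idfun).
- by move: t; apply: tens_ext => [a x y|a x y|u v]; rewrite ?linearP // tmapE.
- exact: subb_valK.
move=> s; rewrite /= tmap_comp (@eq_tmap _ _ _ _ _ _ idfun _ idfun);
  try exact: subb_valK.
by move: s; apply: tens_ext => [a x y|a x y|u v]; rewrite ?linearP // tmapE.
Qed.

Fact subb_comulA s : tassoc (tmap subb_comul idfun (subb_comul s)) =
  tmap idfun subb_comul (subb_comul s).
Proof.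
apply: tmap3_subb_inj; rewrite -tassoc_nat !(tmap_comp _ _ _ _ (subb_comul s)).
rewrite (@eq_tmap _ _ _ _ _ _ (comul \o subb_val) _ (idfun \o subb_val)) //;
  last exact: subb_comulE.
rewrite (@eq_tmap _ _ _ _ _ (subb_val \o _) (idfun \o subb_val) _
  (comul \o subb_val)) //; last exact: subb_comulE.
by rewrite -!tmap_comp subb_comulE comulA.
Qed.
Fact subb_counitl s : contractl subb_counit (subb_comul s) = s.
Proof.
apply: subb_val_inj; rewrite -[RHS]counitl -subb_comulE.
exact/esym/contractl_tmap.
Qed.
Fact subb_counitr s : contractr subb_counit (subb_comul s) = s.
Proof.
apply: subb_val_inj; rewrite -[RHS]counitr -subb_comulE.
exact/esym/contractr_tmap.
Qed.
HB.instance Definition _ := Lmodule_isCoalgebra.Build K subb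
  subb_comulA subb_counitl subb_counitr.

Fact subb_comul_monoid : monoid_morphism (comul : subb -> subb ⊗ subb).
Proof.
split=> [|s t]; apply: tmap_subb_inj.
  by rewrite [LHS]subb_comulE !rmorph1.
by rewrite [LHS]subb_comulE !rmorphM /= !subb_comulE.
Qed.
Fact subb_counit_monoid : monoid_morphism (counit : subb -> K^o).
Proof. by split=> [|s t]; [exact: rmorph1|exact: rmorphM]. Qed.
HB.instance Definition _ :=
  isBialgebra.Build K subb subb_comul_monoid subb_counit_monoid.

Lemma comul_subb s : tmap subb_val subb_val (comul s) = comul (subb_val s).
Proof. exact: subb_comulE. Qed.
Lemma counit_subb s : counit (subb_val s) = counit s.
Proof. by []. Qed.
End SubBialgebra.

Section Measuring.
Variable K : fieldType.

Definition measuring (C : coalgType K) (A B : algType K)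
    (sigma : C -> {linear A -> B}) : Prop :=
  [/\ forall a, linear (fun c => sigma c a),
      forall c a a', sigma c (a * a') =
        tlift (fun c1 c2 => sigma c1 a * sigma c2 a') (comul c)
    & forall c, sigma c 1 = (counit c : K) *: 1].

Definition universal_measuring (A B : algType K) (P : coalgType K)
    (pi : P -> {linear A -> B}) : Prop :=
  measuring pi /\
  forall (C : coalgType K) (sigma : C -> {linear A -> B}), measuring sigma ->
    exists! rho : C -> P,
      coalg_morphism rho /\ forall c, pi (rho c) =1 sigma c.

(* The bialgebra P(A, A), with pi an algebra homomorphism. As in the          *)
(* library's algebra 'End(A) (lfun_mulE), the product of two endomorphisms is *)
(* composition in diagrammatic order, f * g = g \o f. The order matters below: *)
(* under the pairing <p, f (x) v> = f (pi p v) the convolution product of the *)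
(* dual of the FRT bialgebra corresponds to the order f \o g, whence opbialg. *)
Definition universal_measuring_bialgebra (A : algType K) (P : bialgType K)
    (pi : P -> {linear A -> A}) : Prop :=
  [/\ universal_measuring pi, pi 1 =1 id
    & forall p q, pi (p * q) =1 pi q \o pi p].

(* The finite dual P(H, K) of a bialgebra H, with the convolution product.    *)
Definition finite_dual (H D : bialgType K) (ev : D -> {linear H -> K^o}) : Prop :=
  [/\ universal_measuring ev, forall h, ev 1 h = counit h
    & forall d d' h, ev (d * d') h =
        tlift (fun h1 h2 => ev d h1 * ev d' h2) (comul h)].

Definition bialg_isomorphic (A B : bialgType K) : Prop :=
  exists phi : {lrmorphism A -> B}, bijective phi /\ coalg_morphism phi.

End Measuring.

Section Braiding.
Variables (K : fieldType) (V : vectType K).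
Local Notation T := (talg V).

Definition braiding (R : V ⊗ V -> V ⊗ V) : Prop :=
  let R12 : (V ⊗ V) ⊗ V -> (V ⊗ V) ⊗ V := tmap R idfun in
  let R23 := @tassocV K V V V \o tmap idfun R \o @tassoc K V V V in
  bijective R /\ R23 \o R12 \o R23 =1 R12 \o R23 \o R12.

Lemma tgen_inj : injective (@tgen K V).
Proof.
move=> u v uv; have e (l : dual V) : (l : 'Hom(V, K^o)) u = (l : 'Hom(V, K^o)) v.
  by rewrite -!(@talg_lift_gen K V K^o (l : 'Hom(V, K^o))) uv.
by rewrite (ebasis_sum u) (ebasis_sum v); apply: eq_bigr => i _; rewrite e.
Qed.

(* The map s is the restriction of sigma to V, which is unique by tgen_inj.   *)
Definition preserves (R : V ⊗ V -> V ⊗ V) (C : coalgType K)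
    (sigma : C -> {linear T -> T}) : Prop :=
  exists s : C -> {linear V -> V},
    (forall c v, sigma c (tgen v) = tgen (s c v)) /\
    (forall c v w,
      let act := fun x => tlift (fun c1 c2 => tmap (s c1) (s c2) x) (comul c) in
      R (act (v *t w)) = act (R (v *t w))).

Section TransformationAlgebra.
Variables (P : bialgType K) (pi : P -> {linear T -> T}).

Definition stabilizes (p : P) : Prop := forall v, exists w, pi p (tgen v) = tgen w.

Definition preserving_subbialg (R : V ⊗ V -> V ⊗ V) (S : subbialg P) : Prop :=
  (forall p, p \in S -> stabilizes p) /\
  preserves R (fun p : subb S => pi (subb_val p)).

Definition transformation_algebra (R : V ⊗ V -> V ⊗ V) (S : subbialg P) : Prop :=
  preserving_subbialg R S /\
  forall S' : subbialg P, preserving_subbialg R S' ->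
    {subset S <= S'} -> {subset S' <= S}.

End TransformationAlgebra.
End Braiding.

(* Main.v *)
(* A measuring map C -> Hom(A, B) is the same thing as an algebra map from A  *)
(* to the convolution algebra Hom(C, B). Since TV is free on V and A(R) is a  *)
(* quotient of T(V^* (x) V), a measuring map into End(TV) stabilizing V, or   *)
(* into Hom(A(R), k), is determined by a linear action s : C -> End(V), via   *)
(* <c, f (x) v> = f (s c v); the relations of A(R) hold exactly when s        *)
(* preserves R. Thus PR acts on V and this gives phi : PR -> D, while D acts  *)
(* on V and this gives psi : D -> P, reversing products. By uniqueness        *)
(* psi \o phi is the inclusion of PR, so the image of psi contains PR; being  *)
(* a sub-bialgebra preserving R, it equals PR by maximality, and phi and psi  *)
(* are inverse to each other.                                                 *)
Require Import Defs.
From HB Require Import structures.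
From mathcomp Require Import all_boot all_order all_algebra.
From mathcomp Require Import boolp functions.
From mathcomp Require Import reals complex.

Set Implicit Arguments.
Unset Strict Implicit.
Unset Printing Implicit Defensive.

Import GRing.Theory.
Local Open Scope ring_scope.

(** Both universal objects turn linear families of endomorphisms of V into coalgebra maps. As TV is
    free on V, any family [s], linear in c, gives a map into P ([map_to_end]). It gives a map into
    the dual of A(R) when its diagonal action on V ⊗ V commutes with R ([map_to_dual]), because a
    quadratic element of the tensor algebra on [coend V] evaluates to a matrix coefficient of that
    action ([measuring_frt_N]).

    Uniqueness reduces each comparison to generators ([pi_uniq], [measuring_frt_ext]). The action of
    [PR] on V yields [phi : PR -> D], the action of [D] yields [psi : D -> P], and [psi \o phi] is
    the inclusion. The image of [psi] is a sub-bialgebra preserving R ([dual_subbialg_preserving]),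
    so maximality identifies it with [PR]. The order of multiplication flips because the convolution
    product of d and d' acts on V as d after d' ([dual_actM]), whereas [pi (p * q)] applies p before
    q. *)

Section TensorLemmas.

(** * Linear and bilinear maps on tensor products *)

Variable K : fieldType.

Definition pack_linear (U V : lmodType K) (f : U -> V) (lf : linear f) :
  {linear U -> V} := HB.pack f (GRing.isLinear.Build K U V _ f lf).

Lemma linear_comb (U V : lmodType K) (f g : U -> V) (a : K) :
  linear f -> linear g -> linear (fun x => a *: f x + g x).
Proof.
move=> lf lg b x y; rewrite lf lg !scalerDr !scalerA [a * b]mulrC.
by rewrite addrACA.
Qed.

Lemma bilin_postcomp (U V W X : lmodType K) (b : U -> V -> X)
    (f : {linear X -> W}) :
  bilin b -> bilin (fun u v => f (b u v)).
Proof. exact/bilin_comp/linearP. Qed.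

Lemma bilin_mul (A : algType K) : bilin (fun x y : A => x * y).
Proof.
split=> [y a x x'|x a y y'] /=; first by rewrite mulrDl scalerAl.
by rewrite mulrDr scalerAr.
Qed.

Lemma bilin_precomp (U V W U' V' : lmodType K) (b : U -> V -> W)
    (f : U' -> U) (g : V' -> V) :
  linear f -> linear g -> bilin b -> bilin (fun u v => b (f u) (g v)).
Proof.
move=> lf lg bb; split=> [v a u u'|u a v v'] /=; first by rewrite lf (bb.1 _ a).
by rewrite lg bb.2.
Qed.

Lemma eq_tlift (U V W : lmodType K) (b b' : U -> V -> W) (t : U ⊗ V) :
  (forall u v, b u v = b' u v) -> tlift b t = tlift b' t.
Proof. by move=> e; congr (tlift _ t); apply/funext=> u; apply/funext=> v. Qed.

Lemma tlift_tmap (U V W U' V' : lmodType K) (b : U -> V -> W)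
    (f : {linear U' -> U}) (g : {linear V' -> V}) t :
  bilin b -> tlift b (tmap f g t) = tlift (fun u v => b (f u) (g v)) t.
Proof.
move=> bb; have bb' := bilin_precomp (@linearP _ _ _ _ f) (@linearP _ _ _ _ g) bb.
move: t; apply: tens_ext => [a x y||u v].
- by rewrite linearP (tlift_linear bb).
- exact: tlift_linear.
by rewrite tmapE !tliftE.
Qed.

Lemma linear_tlift (U V W W' : lmodType K) (b : U -> V -> W)
    (f : {linear W -> W'}) t :
  bilin b -> f (tlift b t) = tlift (fun u v => f (b u v)) t.
Proof.
move=> bb; move: t; apply: tens_ext => [a x y||u v].
- by rewrite (tlift_linear bb) linearP.
- exact/tlift_linear/bilin_postcomp.
by rewrite !tliftE //; apply: bilin_postcomp.
Qed.

End TensorLemmas.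

(** * Coalgebra morphisms *)

Section CoalgebraMorphisms.
Variable K : fieldType.

Lemma coalg_morphism_id (C : coalgType K) : coalg_morphism (idfun : C -> C).
Proof.
split=> // c; move: (comul c); apply: tens_ext => [//|a x y|u v].
  by rewrite linearP.
by rewrite tmapE.
Qed.

Lemma coalg_morphism_comp (C D E : coalgType K) (g : D -> E) (f : C -> D) :
  coalg_morphism g -> coalg_morphism f -> coalg_morphism (g \o f).
Proof.
move=> [lg gD gE] [lf fD fE]; split=> [a x y|c|c] /=; first by rewrite lf lg.
  by rewrite gD fD (tmap_comp (pack_linear lg) (pack_linear lg)
    (pack_linear lf) (pack_linear lf)).
by rewrite gE fE.
Qed.

Lemma coalg_morphism_subb_val (A : bialgType K) (S : subbialg A) :
  coalg_morphism (@subb_val K A S).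
Proof.
by split=> [|s|s]; [exact: linearP|rewrite comul_subb|rewrite counit_subb].
Qed.

(** The identities can be checked in A, since the inclusion of S stays injective after tensoring
    with itself. *)
Lemma coalg_morphism_corestr (C : coalgType K) (A : bialgType K) (S : subbialg A)
    (f : C -> A) (fS : forall c, f c \in S) :
  coalg_morphism f -> coalg_morphism (fun c => SubB (fS c)).
Proof.
move=> [lf fD fE].
have lF : linear (fun c => SubB (fS c)).
  by move=> a x y; apply: subb_val_inj; rewrite linearP /= lf.
split=> [|c|c]; [exact: lF| |exact: fE].
apply: tmap_subb_inj; rewrite comul_subb /= fD.
by rewrite (tmap_comp _ _ (pack_linear lF) (pack_linear lF)).
Qed.
End CoalgebraMorphisms.

(** * The tensor product of two coalgebras *)

Section TensorCoalgebra.
Variables (K : fieldType) (C D : coalgType K).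

Definition tens_comul : C ⊗ D -> (C ⊗ D) ⊗ (C ⊗ D) :=
  @tmid K C C D D \o tmap comul comul.
Definition tens_counit : C ⊗ D -> K^o := contractl counit \o tmap idfun counit.
HB.instance Definition _ := GRing.Linear.on tens_comul.
HB.instance Definition _ := GRing.Linear.on tens_counit.

Lemma tens_comulE c d : tens_comul (c *t d) = tmid (comul c *t comul d).
Proof. by rewrite /tens_comul /= tmapE. Qed.
Lemma tens_counitE c d : tens_counit (c *t d) = (counit c : K) *: counit d.
Proof. by rewrite /tens_counit /= tmapE contractlE. Qed.

Fact tens_comulA (t : C ⊗ D) :
  tassoc (tmap tens_comul idfun (tens_comul t)) =
  tmap idfun tens_comul (tens_comul t).
Proof.
(* [M] interleaves three factors from C with three from D; both sides are [M] applied to iterated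
   comultiplications of c and d. *)
pose M (x : C ⊗ (C ⊗ C)) (y : D ⊗ (D ⊗ D)) :=
  tmap idfun (@tmid K C C D D) (tmid (x *t y)).
have bM : bilin M by exact: (bilin_postcomp (tmap idfun (@tmid K C C D D) \o
  @tmid K C (C ⊗ C) D (D ⊗ D)) (@bilin_tens K _ _)).
move: t; apply: tens_ext => [a x y|a x y|c d]; rewrite ?linearP //.
rewrite !tens_comulE.
transitivity (M (tassoc (tmap comul idfun (comul c)))
                (tassoc (tmap comul idfun (comul d)))).
  move: (comul c) (comul d); apply: bilin_ext.
  - exact: (bilin_postcomp (@tassoc K _ _ _ \o (tmap tens_comul idfun \o
      @tmid K C C D D)) (@bilin_tens K _ _)).
  - exact: (bilin_precomp (@linearP _ _ _ _ (@tassoc K _ _ _ \o tmap comul idfun))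
      (@linearP _ _ _ _ (@tassoc K _ _ _ \o tmap comul idfun)) bM).
  move=> u v x y; rewrite tmidE !tmapE /= tens_comulE.
  move: (comul u) (comul x); apply: bilin_ext.
  - apply: (bilin_postcomp (@tassoc K _ _ _)
      (b := fun s u => tmid (s *t u) *t (v *t y))).
    exact: bilin_comp ((@bilin_tens K _ _).1 (v *t y))
      (bilin_postcomp (@tmid K C C D D) (@bilin_tens K _ _)).
  - by apply: (bilin_precomp _ _ bM) => a p q; rewrite tensDl tensZl linearP.
  by move=> a b e f; rewrite /M tmidE !tassocE tmidE tmapE /= tmidE.
rewrite !comulA; move: (comul c) (comul d); apply: bilin_ext.
- exact: (bilin_precomp (@linearP _ _ _ _ (tmap idfun comul))
      (@linearP _ _ _ _ (tmap idfun comul)) bM).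
- exact: (bilin_postcomp (tmap idfun tens_comul \o
      @tmid K C C D D) (@bilin_tens K _ _)).
by move=> u v x y; rewrite /M tmidE !tmapE /= tmidE tmapE /= tens_comulE.
Qed.
Fact tens_counitl (t : C ⊗ D) : contractl tens_counit (tens_comul t) = t.
Proof.
move: t; apply: tens_ext => [a x y|a x y|c d]; rewrite ?linearP //.
rewrite tens_comulE -{2}(counitl c) -{2}(counitl d).
move: (comul c) (comul d); apply: bilin_ext.
- exact: (bilin_postcomp (contractl tens_counit \o
      @tmid K C C D D) (@bilin_tens K _ _)).
- apply: bilin_precomp (@bilin_tens _ _ _); exact: linearP.
move=> u v x y; rewrite tmidE !contractlE /= tens_counitE.
by rewrite tensZl tensZr scalerA.
Qed.
Fact tens_counitr (t : C ⊗ D) : contractr tens_counit (tens_comul t) = t.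
Proof.
move: t; apply: tens_ext => [a x y|a x y|c d]; rewrite ?linearP //.
rewrite tens_comulE -{2}(counitr c) -{2}(counitr d).
move: (comul c) (comul d); apply: bilin_ext.
- exact: (bilin_postcomp (contractr tens_counit \o
      @tmid K C C D D) (@bilin_tens K _ _)).
- apply: bilin_precomp (@bilin_tens _ _ _); exact: linearP.
move=> u v x y; rewrite tmidE !contractrE /= tens_counitE.
by rewrite tensZl tensZr scalerA.
Qed.
HB.instance Definition _ := Lmodule_isCoalgebra.Build K (C ⊗ D)%type
  tens_comulA tens_counitl tens_counitr.

Lemma comul_tens (c : C) (d : D) : comul (c *t d) = tmid (comul c *t comul d).
Proof. exact: tens_comulE. Qed.
Lemma counit_tens (c : C) (d : D) : counit (c *t d) = (counit c : K) *: counit d.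
Proof. exact: tens_counitE. Qed.

(** Holds because comultiplication and counit of A are multiplicative. With identities it says that
    multiplication is a coalgebra map; over [opbialg], so is the reversed product. *)
Lemma coalg_morphism_mul (A : bialgType K) (f : C -> A) (g : D -> A) :
  coalg_morphism f -> coalg_morphism g ->
  coalg_morphism (tlift (fun c d => f c * g d) : C ⊗ D -> A).
Proof.
move=> [lf fD fE] [lg gD gE].
have bm : bilin (fun c d => f c * g d) by exact: bilin_precomp (bilin_mul A).
pose h : {linear C ⊗ D -> A} := pack_linear (tlift_linear bm).
have hE c d : h (c *t d) = f c * g d by exact: tliftE.
rewrite -[tlift _]/(h : _ -> _); split; first exact: linearP.
  apply: tens_ext => [a x y|a x y|c d]; rewrite ?linearP //.
  rewrite hE rmorphM /= fD gD comul_tens.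
  move: (comul c) (comul d); apply: bilin_ext.
  - apply: bilin_precomp (bilin_mul _);
      exact: (@linearP _ _ _ _ (tmap (pack_linear _) (pack_linear _))).
  - exact: (bilin_postcomp (tmap h h \o @tmid K C C D D) (@bilin_tens K _ _)).
  move=> u v x y; rewrite tmidE (tmapE (pack_linear lf) (pack_linear lf)).
  rewrite (tmapE (pack_linear lg) (pack_linear lg)) tens_mulE -!hE.
  exact/esym/(tmapE h h).
apply: tens_ext => [a x y|a x y|c d]; rewrite ?linearP //.
by rewrite hE rmorphM /= fE gE counit_tens.
Qed.

End TensorCoalgebra.

(** * The convolution algebra Hom(C, B) *)

(* C is a bialgebra, rather than a coalgebra, only to make the counit, which  *)
(* is the unit of the convolution algebra, nonzero.                           *)
Section ConvolutionAlgebra.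
Variables (K : fieldType) (C : bialgType K) (B : algType K).

Definition is_conv : {pred C -> B} := fun f => `[< linear f >].
Record conv : Type := Conv {
  conv_fun :> C -> B; conv_funP : conv_fun \in is_conv }.
HB.instance Definition _ := [isSub for conv_fun].
HB.instance Definition _ := [Choice of conv by <:].

Fact is_conv_submod : submod_closed is_conv.
Proof.
split=> [|a f g /asboolP lf /asboolP lg]; apply/asboolP => b x y.
  by rewrite /= scaler0 addr0.
rewrite [LHS](_ : _ = a *: f (b *: x + y) + g (b *: x + y)) //.
rewrite lf lg [RHS](_ : _ = b *: (a *: f x + g x) + (a *: f y + g y)) //.
by rewrite !scalerDr addrACA !scalerA [a * b]mulrC.
Qed.
HB.instance Definition _ := GRing.SubChoice_isSubLmodule.Build K (C -> B) _ conv
  (GRing.submod_closed_semi is_conv_submod).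

Lemma conv_linear (f : conv) : linear f.
Proof. by case: f => f /= /asboolP. Qed.
HB.instance Definition _ (f : conv) :=
  GRing.isLinear.Build K C B _ (conv_fun f) (conv_linear f).

Definition conv_pack (f : C -> B) (lf : linear f) : conv := Conv (asboolT lf).

Lemma convP (f g : conv) : f =1 g -> f = g.
Proof. by move=> /funext e; apply: val_inj. Qed.

Lemma conv_addE (f g : conv) c : (f + g) c = f c + g c.
Proof. by []. Qed.
Lemma conv_scaleE a (f : conv) c : (a *: f) c = a *: f c.
Proof. by []. Qed.

Lemma bilin_conv (f g : conv) : bilin (fun c1 c2 => f c1 * g c2).
Proof. by apply: bilin_precomp (bilin_mul B); exact: linearP. Qed.

Definition conv_mul_fun (f g : conv) (c : C) : B :=
  tlift (fun c1 c2 => f c1 * g c2) (comul c).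
Fact conv_mul_linear f g : linear (conv_mul_fun f g).
Proof.
by move=> a x y; rewrite /conv_mul_fun linearP (tlift_linear (bilin_conv f g)).
Qed.
Definition conv_mul f g := conv_pack (conv_mul_linear f g).

Fact conv_one_linear : linear (fun c : C => (counit c : K) *: (1 : B)).
Proof. by move=> a x y; rewrite linearP scalerDl -scalerA. Qed.
Definition conv_one := conv_pack conv_one_linear.

Lemma conv_mulE f g c :
  conv_mul f g c = tlift (fun c1 c2 => f c1 * g c2) (comul c).
Proof. by []. Qed.

Fact conv_mulA : associative conv_mul.
Proof.
move=> f g h; apply: convP => c.
rewrite !conv_mulE.
(* The threefold product on right-bracketed tensors; coassociativity brings the left-bracketed
   product to it. *)
pose M3 := tlift (fun x s => f x * tlift (fun y z => g y * h z) s).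
have b3 : bilin (fun x s => f x * tlift (fun y z => g y * h z) s).
  apply: (bilin_precomp _ _ (bilin_mul B)); first exact: linearP.
  exact/tlift_linear/bilin_conv.
have lM : linear M3 := tlift_linear b3.
transitivity (M3 (tmap idfun comul (comul c))).
  by rewrite /M3 (tlift_tmap _ _ _ b3); apply: eq_tlift.
rewrite -comulA; move: (comul c); apply: tens_ext => [a x y||x y].
- by rewrite !linearP lM.
- exact/tlift_linear/bilin_conv.
rewrite tmapE (tliftE (bilin_conv (conv_mul f g) h)) conv_mulE /=.
move: (comul x); apply: tens_ext => [a s t|a s t|u v].
- by rewrite tensDl tensZl linearP lM.
- by rewrite (tlift_linear (bilin_conv f g)) mulrDl scalerAl.
by rewrite tassocE /M3 (tliftE b3) !(tliftE (bilin_conv _ _)) mulrA.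
Qed.
Fact conv_mul1l : left_id conv_one conv_mul.
Proof.
move=> f; apply: convP => c; rewrite conv_mulE -{2}(counitl c).
rewrite [RHS]linear_tlift; last exact: bilin_contractl.
by apply: eq_tlift => x y /=; rewrite linearZ /= -scalerAl mul1r.
Qed.
Fact conv_mul1r : right_id conv_one conv_mul.
Proof.
move=> f; apply: convP => c; rewrite conv_mulE -{2}(counitr c).
rewrite [RHS]linear_tlift; last exact: bilin_contractr.
by apply: eq_tlift => x y /=; rewrite linearZ /= -scalerAr mulr1.
Qed.

Lemma tlift_comb (a : K) (b b1 b2 : C -> C -> B) t :
  bilin b -> bilin b1 -> bilin b2 ->
  (forall x y, b x y = a *: b1 x y + b2 x y) ->
  tlift b t = a *: tlift b1 t + tlift b2 t.
Proof.
move=> bb bb1 bb2 e; move: t; apply: tens_ext => [||u v].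
- exact: tlift_linear.
- by apply: linear_comb; apply: tlift_linear.
by rewrite !tliftE.
Qed.

Fact conv_mulPl (a : K) (f g h : conv) :
  conv_mul (a *: f + g) h = a *: conv_mul f h + conv_mul g h.
Proof.
apply: convP => c; rewrite conv_addE conv_scaleE !conv_mulE.
apply: tlift_comb; try exact: bilin_conv.
by move=> x y; rewrite conv_addE conv_scaleE mulrDl scalerAl.
Qed.
Fact conv_mulPr (a : K) (f g h : conv) :
  conv_mul h (a *: f + g) = a *: conv_mul h f + conv_mul h g.
Proof.
apply: convP => c; rewrite conv_addE conv_scaleE !conv_mulE.
apply: tlift_comb; try exact: bilin_conv.
by move=> x y; rewrite conv_addE conv_scaleE mulrDr scalerAr.
Qed.
Fact conv_mulDl : left_distributive conv_mul +%R.
Proof. by move=> f g h; have := conv_mulPl 1 f g h; rewrite !scale1r. Qed.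
Fact conv_mulDr : right_distributive conv_mul +%R.
Proof. by move=> h f g; have := conv_mulPr 1 f g h; rewrite !scale1r. Qed.
Fact conv_one_neq0 : conv_one != 0.
Proof.
apply/eqP => e; have /eqP : conv_one 1 = 0 by rewrite e.
by rewrite /= (rmorph1 (counit : C -> K^o)) scale1r oner_eq0.
Qed.
HB.instance Definition _ := GRing.Zmodule_isNzRing.Build conv
  conv_mulA conv_mul1l conv_mul1r conv_mulDl conv_mulDr conv_one_neq0.
Fact conv_scaleAl (a : K) (f g : conv) : a *: (f * g) = (a *: f) * g.
Proof.
have := conv_mulPl a f 0 g.
by rewrite addr0 [X in _ + X](mul0r g) addr0 => e; apply/esym.
Qed.
HB.instance Definition _ := GRing.Lmodule_isLalgebra.Build K conv conv_scaleAl.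
Fact conv_scaleAr (a : K) (f g : conv) : a *: (f * g) = f * (a *: g).
Proof.
have := conv_mulPr a g 0 f.
by rewrite addr0 [X in _ + X](mulr0 f) addr0 => e; apply/esym.
Qed.
HB.instance Definition _ := GRing.Lalgebra_isAlgebra.Build K conv conv_scaleAr.

Lemma convM (f g : conv) c :
  (f * g) c = tlift (fun c1 c2 => f c1 * g c2) (comul c).
Proof. by []. Qed.
Lemma conv1E c : (1 : conv) c = (counit c : K) *: 1.
Proof. by []. Qed.
End ConvolutionAlgebra.

(** * Measuring maps as algebra maps into a convolution algebra *)

Section Measuring.
Variable K : fieldType.

Section ConvMeasuring.
Variables (C : bialgType K) (A B : algType K) (F : {lrmorphism A -> conv C B}).

Fact conv_measuring_linear c : linear (fun a => F a c).
Proof. by move=> a x y; rewrite linearP. Qed.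
Definition conv_measuring c : {linear A -> B} :=
  pack_linear (conv_measuring_linear c).

Lemma conv_measuringP : measuring conv_measuring.
Proof.
split=> [a|c a a'|c] /=; first exact: linearP.
  by rewrite rmorphM convM.
by rewrite rmorph1 conv1E.
Qed.
End ConvMeasuring.

Section Theory.
Variables (C : coalgType K) (A B : algType K) (sigma : C -> {linear A -> B}).
Hypothesis sigmaM : measuring sigma.

Lemma bilin_measuring a a' : bilin (fun c1 c2 => sigma c1 a * sigma c2 a').
Proof. by case: sigmaM => l _ _; apply: bilin_precomp (bilin_mul B). Qed.

Lemma measuring_comp (A' : algType K) (f : {lrmorphism A' -> A}) :
  measuring (fun c => sigma c \o f : {linear A' -> B}).
Proof.
case: sigmaM => l m u; split=> [a|c a a'|c] /=; first exact: l.
  by rewrite rmorphM m.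
by rewrite rmorph1.
Qed.

Lemma measuring_coalg (C' : coalgType K) (rho : C' -> C) :
  coalg_morphism rho -> measuring (fun c => sigma (rho c)).
Proof.
case: sigmaM => l m u [lr rD rE]; split=> [a b x y|c a a'|c].
- by rewrite lr l.
- rewrite m rD -[rho]/(pack_linear lr : _ -> _) tlift_tmap //.
  exact: bilin_measuring.
- by rewrite u rE.
Qed.
End Theory.

(** V generates TV, and the measuring identities carry agreement to products. The induction keeps c
    general, as the product rule evaluates at the components of [comul c]. *)
Lemma measuring_talg_ext (C : coalgType K) (V : lmodType K) (B : algType K)
    (sigma sigma' : C -> {linear talg V -> B}) :
  measuring sigma -> measuring sigma' ->
  (forall c v, sigma c (tgen v) = sigma' c (tgen v)) ->
  forall c, sigma c =1 sigma' c.
Proof.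
move=> [_ m u] [_ m' u'] e c t; elim/talg_ind: t c
  => [v|| s t Hs Ht|a t Ht|s t Hs Ht] c.
- exact: e.
- by rewrite u u'.
- by rewrite !linearD /= Hs Ht.
- by rewrite !linearZ /= Ht.
- by rewrite m m'; apply: eq_tlift => c1 c2; rewrite Hs Ht.
Qed.

(** Both maps factor the same measuring map, the pullback of [pi] along [rho']. *)
Lemma universal_measuring_uniq (A B : algType K) (P C : coalgType K)
    (pi : P -> {linear A -> B}) (rho rho' : C -> P) :
  universal_measuring pi -> coalg_morphism rho -> coalg_morphism rho' ->
  (forall c, pi (rho c) =1 pi (rho' c)) -> rho =1 rho'.
Proof.
move=> [mp up] cr cr' e c.
have [r [_ ru]] := up _ _ (measuring_coalg mp cr').
by rewrite -(ru rho _) // -(ru rho' _).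
Qed.
End Measuring.

(** * Functionals on [coend V] as endomorphisms of V, and the diagonal action *)

Section CoendAction.
Variables (K : fieldType) (V : vectType K).
Local Notation app f v := ((f : 'Hom(V, K^o)) v).

(** The endomorphism whose matrix coefficients are the values of [l], as [coend_actE] states. *)
Definition coend_act_fun (l : coend V -> K^o) (v : V) : V :=
  \sum_i (l (edual i *t v : coend V) : K) *: ebasis i.
Fact coend_act_linear (l : {linear coend V -> K^o}) : linear (coend_act_fun l).
Proof.
move=> a v w; rewrite /coend_act_fun scaler_sumr -big_split.
by apply: eq_bigr => i _; rewrite tensDr tensZr linearP /= scalerDl scalerA.
Qed.
Definition coend_act l : {linear V -> V} := pack_linear (coend_act_linear l).

Lemma coend_actE l (f : dual V) v : app f (coend_act l v) = l (f *t v : coend V).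
Proof.
rewrite linear_sum [in RHS](edual_sum f) tens_suml linear_sum.
by apply: eq_bigr => i _; rewrite linearZ /= tensZl linearZ /=; apply: mulrC.
Qed.

Lemma dual_sep (v w : V) : (forall f : dual V, app f v = app f w) -> v = w.
Proof.
move=> e; rewrite (ebasis_sum v) (ebasis_sum w).
by apply: eq_bigr => i _; rewrite e.
Qed.

Lemma tpair_sep (x y : V ⊗ V) : (forall t, tpair t x = tpair t y) -> x = y.
Proof.
move=> e; rewrite (tpair_basis x) (tpair_basis y).
by apply: eq_bigr => i _; apply: eq_bigr => j _; rewrite e.
Qed.

Section Diagonal.
Variables (C : coalgType K) (s : C -> {linear V -> V}).
Hypothesis s_linear : forall v, linear (fun c => s c v).

Definition diag_act (c : C) (x : V ⊗ V) : V ⊗ V :=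
  tlift (fun c1 c2 => tmap (s c1) (s c2) x) (comul c).

Lemma bilin_diag_act x : bilin (fun c1 c2 => tmap (s c1) (s c2) x).
Proof.
split=> [d a c c'|d a c c']; move: x;
  apply: tens_ext => [||u v]; try exact: linearP;
  try (apply: linear_comb; exact: linearP).
  by rewrite !tmapE s_linear tensDl tensZl.
by rewrite !tmapE s_linear tensDr tensZr.
Qed.

Lemma diag_act_linear c : linear (diag_act c).
Proof.
apply: (tlift_bilin _ _).2 => [x|c1 c2]; first exact: bilin_diag_act.
exact: linearP.
Qed.

Lemma diag_act_pair (f g : dual V) (v w : V) c :
  tpair (f *t g) (diag_act c (v *t w)) =
  tlift (fun c1 c2 => app f (s c1 v) * app g (s c2 w) : K^o) (comul c).
Proof.
rewrite linear_tlift; last exact: bilin_diag_act.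
by apply: eq_tlift => c1 c2; rewrite tmapE /= tpairE.
Qed.

(** The bridge between relations and actions: [frt_N t x] is a sum of products of two generators,
    and [sigma] splits each product along [comul c], just as [diag_act] does. *)
Lemma measuring_frt_N (sigma : C -> {linear talg (coend V) -> K^o}) :
  measuring sigma ->
  (forall c (f : dual V) v, sigma c (tgen (f *t v : coend V)) = app f (s c v)) ->
  forall c t x, sigma c (frt_N t x) = tpair t (diag_act c x).
Proof.
move=> [_ sM _] sE c; apply: bilin_ext => [||f g v w].
- exact: bilin_postcomp (@bilin_frt_N K V).
- apply: bilin_compr (diag_act_linear c) (@bilin_tpair K V).
rewrite frt_N_tens sM diag_act_pair.
by apply: eq_tlift => c1 c2; rewrite !sE.
Qed.
End Diagonal.
End CoendAction.

(** * Maps out of A(R) and into its finite dual *)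

Section FrtMaps.
Variables (K : fieldType) (V : vectType K) (R : {linear V ⊗ V -> V ⊗ V}).
Local Notation app f v := ((f : 'Hom(V, K^o)) v).
Local Notation q := (bproj (frt_biideal R)).

Lemma frt_lift (B : algType K) (G : {lrmorphism talg (coend V) -> B}) :
  (forall t s, G (frt_N (tdual R t) s) = G (frt_N t (R s))) ->
  exists G' : {lrmorphism frt R -> B}, forall t, G' (q t) = G t.
Proof.
move=> GR; have GJ a : frt_ideal R a -> G a = 0.
  by apply: ideal_gen_ker; apply: frt_rel_ker.
pose G' : frt R -> B := aquot_lift (J := frt_ideal R) G.
pose mL := GRing.isLinear.Build K (frt R) B _ G' (aquot_lift_linear GJ).
pose mM := GRing.isMonoidMorphism.Build (frt R) B G' (aquot_lift_monoid GJ).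
pose H : {lrmorphism frt R -> B} := HB.pack G' mL mM.
by exists H => t; apply: aquot_liftE.
Qed.

Lemma frt_relE t s : q (frt_N (tdual R t) s) = q (frt_N t (R s)).
Proof. exact: frt_aproj_N. Qed.

Lemma measuring_frt_ext (C : coalgType K) (B : algType K)
    (sigma sigma' : C -> {linear frt R -> B}) :
  measuring sigma -> measuring sigma' ->
  (forall c (f : dual V) v, sigma c (q (tgen (f *t v : coend V))) =
     sigma' c (q (tgen (f *t v : coend V)))) ->
  forall c, sigma c =1 sigma' c.
Proof.
move=> m m' e c; elim/(@aprojW _ _ (frt_ideal R)) => t.
apply: (measuring_talg_ext (measuring_comp m q) (measuring_comp m' q)) => {}c w.
by move: w; apply: tens_ext => [a x y|a x y|f v] /=; rewrite ?linearP //; apply: e.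
Qed.

Variables (D : coalgType K) (ev : D -> {linear frt R -> K^o}).

(** Sending f ⊗ v to the functional c ↦ f(s c v) defines an algebra map from the free algebra to the
    convolution algebra; it descends to A(R), and universality of [ev] applies. *)
Lemma map_to_dual (C : bialgType K) (s : C -> {linear V -> V}) :
  universal_measuring ev ->
  (forall v, linear (fun c => s c v)) ->
  (forall c x, R (diag_act s c x) = diag_act s c (R x)) ->
  exists2 rho : C -> D, coalg_morphism rho
    & forall c (f : dual V) v,
        ev (rho c) (q (tgen (f *t v : coend V))) = app f (s c v).
Proof.
move=> [_ uev] sl sR.
have bs c : bilin (fun (f : dual V) v => app f (s c v)).
  exact: bilin_compr (@linearP _ _ _ _ (s c)) (@bilin_coend_counit K V).
have gl (w : coend V) :
    linear (fun c => tlift (fun (f : dual V) v => app f (s c v)) w : K^o).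
  apply: (tlift_bilin _ _).2 => [c|f v]; first exact: bs.
  by move=> a c c'; rewrite sl linearP.
have gl2 : linear (fun w : coend V => conv_pack (gl w)).
  by move=> a w w'; apply: convP => c; apply: (tlift_linear (bs c)).
pose G := talg_lift (pack_linear gl2).
have GM := conv_measuringP G.
have Ggen c (f : dual V) v :
    conv_measuring G c (tgen (f *t v : coend V)) = app f (s c v).
  by rewrite -[LHS]/(G (tgen _) c) /G talg_lift_gen; apply: (tliftE (bs c)).
have GN := measuring_frt_N sl GM Ggen.
(* At c the two sides of a relation pair t with R(c·x) and with c·(R x), which agree by [sR]. *)
have [|G' G'E] := @frt_lift (conv C K^o) G.
  move=> t x; apply: convP => c.
  by have := GN c (tdual R t) x; rewrite tdualP sR -GN.
have [rho [[rhoC rhoE] _]] := uev _ _ (conv_measuringP G').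
exists rho => // c f v; rewrite rhoE /= G'E; exact: Ggen.
Qed.

(** The converse passage: [ev d] is defined on the quotient, so it respects the relations, and the
    pairings with all tensors of functionals separate points of V ⊗ V. *)
Lemma dual_diag_act (t : D -> {linear V -> V}) :
  measuring ev -> (forall v, linear (fun d => t d v)) ->
  (forall d (f : dual V) v, ev d (q (tgen (f *t v : coend V))) = app f (t d v)) ->
  forall d x, R (diag_act t d x) = diag_act t d (R x).
Proof.
move=> mev tl tE d x; apply: tpair_sep => u.
have E := measuring_frt_N tl (measuring_comp mev q) tE.
by rewrite -tdualP -!E /= frt_relE.
Qed.

End FrtMaps.

(** * Maps into the universal measuring coalgebra of TV *)

Section EndMaps.
Variables (K : fieldType) (V : vectType K) (P : coalgType K).
Variable (pi : P -> {linear talg V -> talg V}).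

Lemma map_to_end (C : bialgType K) (s : C -> {linear V -> V}) :
  universal_measuring pi -> (forall v, linear (fun c => s c v)) ->
  exists2 rho : C -> P, coalg_morphism rho
    & forall c v, pi (rho c) (tgen v) = tgen (s c v).
Proof.
move=> [_ upi] sl.
have gl (v : V) : linear (fun c => tgen (s c v)).
  by move=> a c c'; rewrite sl linearP.
have gl2 : linear (fun v => conv_pack (gl v)).
  by move=> a v w; apply: convP => c /=; rewrite !linearP.
pose G := talg_lift (pack_linear gl2).
have [rho [[rhoC rhoE] _]] := upi _ _ (conv_measuringP G).
by exists rho => // c v; rewrite rhoE -[LHS]/(G (tgen v) c) /G talg_lift_gen.
Qed.
End EndMaps.

Lemma linear_ebasis (K : fieldType) (V : vectType K) (W : lmodType K)
    (h : {linear V -> W}) v :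
  h v = \sum_i ((edual i : 'Hom(V, K^o)) v : K) *: h (ebasis i).
Proof.
rewrite {1}(ebasis_sum v) linear_sum.
by apply: eq_bigr => i _; rewrite linearZ.
Qed.

(** * The action of the finite dual on V *)

Section DualAction.
Variables (K : fieldType) (V : vectType K) (R : {linear V ⊗ V -> V ⊗ V}).
Variables (D : bialgType K) (ev : D -> {linear frt R -> K^o}).
Hypothesis dualD : finite_dual ev.
Local Notation app f v := ((f : 'Hom(V, K^o)) v).
Local Notation q := (bproj (frt_biideal R)).
Local Notation gen f v := (tgen (f *t v : coend V)).

Definition dual_act (d : D) : {linear V -> V} :=
  coend_act (ev d \o (q \o @tgen K (coend V))).

Lemma dual_actE d (f : dual V) v : ev d (q (gen f v)) = app f (dual_act d v).
Proof. by rewrite coend_actE. Qed.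

Lemma dual_act_linear v : linear (fun d => dual_act d v).
Proof.
move=> a d d'; apply: dual_sep => f; rewrite -dual_actE.
case: dualD => -[[l _ _] _] _ _; rewrite l !dual_actE.
exact/esym/(@linearP _ _ _ _ (f : 'Hom(V, K^o))).
Qed.

(** The comultiplication of [coend V] is dual to matrix multiplication, so convolution becomes
    composition of operators. *)
Lemma dual_actM d d' v : dual_act (d * d') v = dual_act d (dual_act d' v).
Proof.
apply: dual_sep => f; rewrite -dual_actE; case: dualD => -[[l _ _] _] _ ->.
rewrite comul_bproj comul_tgen comul_coend !tmap_sum.
have bb : bilin (fun h1 h2 => ev d h1 * ev d' h2 : K^o).
  by apply: bilin_precomp (bilin_mul K^o); apply: linearP.
rewrite -[tlift _]/(pack_linear (tlift_linear bb) : _ -> _) linear_sum.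
rewrite [RHS](linear_ebasis ((f : 'Hom(V, K^o)) \o dual_act d)).
by apply: eq_bigr => i _; rewrite /= (tliftE bb) !dual_actE; apply: mulrC.
Qed.
End DualAction.

(** [preserves] only asks for linearity of [s c] in v; linearity in c is recovered from that of
    [sigma], as V embeds in TV. *)
Lemma stabilized_linear (K : fieldType) (V : vectType K) (C : lmodType K)
    (sigma : C -> {linear talg V -> talg V}) (s : C -> {linear V -> V}) :
  (forall x, linear (fun c => sigma c x)) ->
  (forall c v, sigma c (tgen v) = tgen (s c v)) ->
  forall v, linear (fun c => s c v).
Proof.
by move=> l e v a c c'; apply: tgen_inj; rewrite -e l !e linearP.
Qed.

(** * The image of the finite dual in P as a sub-bialgebra preserving R *)

Section DualToEnd.
Variables (K : fieldType) (V : vectType K) (R : {linear V ⊗ V -> V ⊗ V}).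
Variables (D : bialgType K) (ev : D -> {linear frt R -> K^o}).
Hypothesis dualD : finite_dual ev.
Variables (P : bialgType K) (pi : P -> {linear talg V -> talg V}).
Hypothesis univP : universal_measuring_bialgebra pi.
Variable psi : D -> P.
Hypothesis psiC : coalg_morphism psi.
Hypothesis psiE : forall d v, pi (psi d) (tgen v) = tgen (dual_act ev d v).

Lemma pi_uniq (C : coalgType K) (rho rho' : C -> P) :
  coalg_morphism rho -> coalg_morphism rho' ->
  (forall c v, pi (rho c) (tgen v) = pi (rho' c) (tgen v)) -> rho =1 rho'.
Proof.
case: univP => up _ _ cr cr' e; apply: (universal_measuring_uniq up cr cr').
exact: measuring_talg_ext (measuring_coalg up.1 cr) (measuring_coalg up.1 cr') e.
Qed.

(* Both sides are coalgebra maps from D (x) D to P with opposite product.     *)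
Lemma dual_to_endM d d' : psi (d * d') = psi d' * psi d.
Proof.
case: univP => -[mp up] _ piM; have [lpi _ _] := mp.
have [lpsi _ _] := psiC.
have c1 : coalg_morphism (tlift (fun d d' : D => d * d')).
  exact: coalg_morphism_mul (coalg_morphism_id D) (coalg_morphism_id D).
pose op d d' := (psi d : opbialg P) * (psi d' : opbialg P).
have c2 : coalg_morphism (tlift op).
  exact: (coalg_morphism_mul (A := opbialg P) psiC psiC).
have bD := bilin_mul D.
have bP : bilin op.
  exact: (@bilin_precomp K (opbialg P) (opbialg P) (opbialg P) D D _ psi psi
    lpsi lpsi (bilin_mul (opbialg P))).
have [l1 _ _] := c1; have [l2 _ _] := c2.
have := pi_uniq (coalg_morphism_comp psiC c1) c2.
move=> /(_ _ (d *t d')); rewrite /= (tliftE bD) (tliftE bP); apply.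
move=> x v; move: x; apply: tens_ext => [a x y|a x y|{}d {}d'] /=.
- by rewrite l1 lpsi lpi.
- by rewrite l2 lpi.
rewrite (tliftE bD) (tliftE bP) psiE (dual_actM dualD).
by rewrite -[RHS]/(pi (psi d' * psi d) _) piM /= !psiE.
Qed.

Definition dual_image : {pred P} := fun p => `[< exists d, psi d = p >].

Lemma mem_dual_image d : psi d \in dual_image.
Proof. by apply/asboolP; exists d. Qed.

(** In the application this holds because the image contains [PR]. *)
Hypothesis dual_image1 : 1 \in dual_image.

Fact dual_image_subalg : subalg_closed dual_image.
Proof.
have [lpsi _ _] := psiC; split=> //.
  move=> a _ _ /asboolP[d <-] /asboolP[d' <-]; rewrite -lpsi.
  exact: mem_dual_image.
move=> _ _ /asboolP[d <-] /asboolP[d' <-]; rewrite -dual_to_endM.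
exact: mem_dual_image.
Qed.

Fact dual_image_comul : {in dual_image, forall p, tens_span dual_image (comul p)}.
Proof.
move=> _ /asboolP[d <-]; have [lpsi -> _] := psiC.
elim/tens_ind: (comul d)
  => [u v|s t [l [lS sE]] [r [rS tE]]|a t [l [/allP lS tE]]].
- exists [:: (psi u, psi v)]; rewrite /= !mem_dual_image big_seq1; split=> //.
  exact: (tmapE (pack_linear lpsi) (pack_linear lpsi)).
- exists (l ++ r); rewrite all_cat lS rS big_cat /= -sE -tE; split=> //.
  exact: (linearD (tmap (pack_linear lpsi) (pack_linear lpsi))).
(* [tens_span] allows no coefficients, so the scalar goes into the left factors. *)
exists [seq (a *: x.1, x.2) | x <- l]; split.
  apply/allP=> _ /mapP[x /lS /andP[x1 x2] ->] /=; rewrite x2 andbT.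
  have [d' <-] := asboolW x1.
  by rewrite -(linearZ_LR (pack_linear lpsi)); apply: mem_dual_image.
rewrite big_map [LHS](linearZ_LR (tmap (pack_linear lpsi) (pack_linear lpsi))) /=.
rewrite -[tmap _ _ t]/(tmap psi psi t) tE scaler_sumr.
by apply: eq_bigr => x _; rewrite tensZl.
Qed.

Definition dual_subbialg : subbialg P :=
  SubBialg dual_image_subalg dual_image_comul.

(** The corestriction of [psi] is a coalgebra map onto the image and matches the two actions on V,
    so compatibility with R is inherited from [dual_diag_act]. *)
Lemma dual_subbialg_preserving : preserving_subbialg pi R dual_subbialg.
Proof.
have [[mpi _] _ _] := univP; have [lpi _ _] := mpi.
split=> [_ /asboolP[d <-] v|]; first by exists (dual_act ev d v); apply: psiE.
have dP (p : subb dual_subbialg) : exists d, psi d = subb_val p.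
  by case: p => p /= /asboolP.
pose s p := dual_act ev (projT1 (cid (dP p))).
have sE p v : pi (subb_val p) (tgen v) = tgen (s p v).
  by rewrite -psiE /s; case: cid => d /= ->.
have sl : forall v, linear (fun p => s p v).
  by apply: stabilized_linear sE => x a p p'; rewrite linearP lpi.
have fS : forall d, psi d \in (dual_subbialg : {pred P}) := mem_dual_image.
pose f d : subb dual_subbialg := SubB (fS d).
have fC : coalg_morphism f by exact: coalg_morphism_corestr.
(* The preimage chosen in [s] does not matter: the action on V can be read off from [pi]. *)
have sf d v : s (f d) v = dual_act ev d v by apply: tgen_inj; rewrite -sE -psiE.
have [lf fD _] := fC.
have actf d x : diag_act s (f d) x = diag_act (dual_act ev) d x.
  rewrite /diag_act fD.
  rewrite -[f]/(pack_linear lf : _ -> _) (tlift_tmap _ _ _ (bilin_diag_act sl x)).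
  apply: eq_tlift => d1 d2; exact: eq_tmap.
have [[mev _] _ _] := dualD.
have Rs p x : R (diag_act s p x) = diag_act s p (R x).
  have [d pd] := dP p; have -> : p = f d by apply: subb_val_inj.
  by rewrite !actf (dual_diag_act mev (dual_act_linear dualD) (dual_actE _)).
by exists s; split=> // p v w; apply: Rs.
Qed.
End DualToEnd.

(** * The mutually inverse bialgebra maps *)

Theorem frt_dual_iso (K : fieldType) (V : vectType K)
    (R : {linear V ⊗ V -> V ⊗ V})
    (P : bialgType K) (pi : P -> {linear talg V -> talg V})
    (PR : subbialg P) (D : bialgType K) (ev : D -> {linear frt R -> K^o}) :
  universal_measuring_bialgebra pi -> transformation_algebra pi R PR ->
  finite_dual ev -> bialg_isomorphic (opbialg (subb PR)) D.
Proof.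
move=> univP [[_ [s [sE sR]]] PRmax] dualD.
have [[mpi upi] pi1 piM] := univP; have [[mev uev] _ _] := dualD.
have [lpi _ _] := mpi.
have sl : forall v, linear (fun p => s p v).
  by apply: stabilized_linear sE => x a p p'; rewrite linearP lpi.
have Rs p x : R (diag_act s p x) = diag_act s p (R x).
  move: x; apply: tens_ext => [a x y|a x y|v w]; last exact: sR.
    by rewrite (diag_act_linear sl) linearP.
  by rewrite linearP (diag_act_linear sl).
have [phi phiC phiE] := map_to_dual (conj mev uev) sl Rs.
have [psi psiC psiE] := map_to_end (conj mpi upi) (dual_act_linear dualD).
have psi_phi p : psi (phi p) = subb_val p.
  apply: (pi_uniq univP (coalg_morphism_comp psiC phiC)
    (coalg_morphism_subb_val PR)) => {}p v.
  rewrite psiE sE; congr tgen; apply: dual_sep => f.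
  by rewrite -dual_actE phiE.
have PRpsi p : p \in PR -> exists d, psi d = p.
  by move=> pPR; exists (phi (SubB pPR)); rewrite psi_phi.
have im1 : 1 \in dual_image psi.
  by apply/asboolP/PRpsi; have [] := subbialg_algP PR.
pose S := dual_subbialg dualD univP psiC psiE im1.
have psiPR d : psi d \in PR.
  (* Maximality only concerns sub-bialgebras containing [PR]; that containment comes from [psi_phi]
     through [PRpsi]. *)
  apply: (PRmax S); first exact: dual_subbialg_preserving.
    by move=> p /PRpsi ?; apply/asboolP.
  exact: mem_dual_image.
pose psi' d : subb PR := SubB (psiPR d).
have psi'C : coalg_morphism psi' by exact: coalg_morphism_corestr.
have phiK : cancel phi psi' by move=> p; apply: subb_val_inj; rewrite /= psi_phi.
(* A coalgebra endomorphism of [D] is determined by [ev] on the generators of A(R), where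
   [phi \o psi'] and the identity induce the same action on V. *)
have psi'K : cancel psi' phi.
  move=> d; have c := coalg_morphism_comp phiC psi'C.
  apply: (universal_measuring_uniq (conj mev uev) c (coalg_morphism_id D)) => {}d.
  apply: (measuring_frt_ext (measuring_coalg mev c) mev) => {}d f v /=.
  rewrite phiE dual_actE; congr (_ _); apply: tgen_inj.
  by rewrite -sE -psiE.
have psi_inj : injective psi.
  by move=> d d' e; apply: (can_inj psi'K); apply: subb_val_inj.
have psiM := dual_to_endM dualD univP psiC psiE.
(* psi 1 is a unit for the image of psi, which contains 1.                    *)
have psi_1 : psi 1 = 1.
  have e : psi (phi 1) = 1 by rewrite psi_phi rmorph1.
  by have := psiM (phi 1) 1; rewrite mulr1 e mulr1.
have [lphi _ _] := phiC.
have phiM : monoid_morphism (phi : opbialg (subb PR) -> D).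
  (* Injectivity of [psi] transfers its antimultiplicativity to [phi], where the reversal is
     absorbed by [opbialg]. *)
  split=> [|x y]; apply: psi_inj; first by rewrite psi_1 psi_phi rmorph1.
  by rewrite psi_phi psiM !psi_phi op_mulE rmorphM.
pose mL := GRing.isLinear.Build K (opbialg (subb PR)) D _ phi lphi.
pose mM := GRing.isMonoidMorphism.Build (opbialg (subb PR)) D phi phiM.
pose H : {lrmorphism opbialg (subb PR) -> D} :=
  HB.pack (phi : opbialg (subb PR) -> D) mL mM.
by exists H; split; [exists psi'|exact: phiC].
Qed.

Theorem corollary4p8 (F : realType) (g : ground)
    (V : vectType (ground_field F g)) (R : {linear V ⊗ V -> V ⊗ V})
    (braidR : braiding R)
    (P : bialgType (ground_field F g)) (pi : P -> {linear talg V -> talg V})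
    (univP : universal_measuring_bialgebra pi)
    (PR : subbialg P) (maxPR : transformation_algebra pi R PR)
    (D : bialgType (ground_field F g))
    (ev : D -> {linear frt R -> (ground_field F g)^o})
    (dualD : finite_dual ev) :
  bialg_isomorphic (opbialg (subb PR)) D.
Proof. exact: frt_dual_iso univP maxPR dualD. Qed.
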